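(* Suppose that the limit $v(y)=\lim_{T\to\infty}v_T(y)$ exists for every $y\in Y$ and that the limit function $v(\cdot)$ is continuous on $Y$. Let $y_0\in Y$ be such that $V_{per}(y_0)=\liminf_{T\to\infty}v_T(y_0)$. Then $k^*(y_0)=d^*(y_0)$.
   Context: Model. $Y\subset\mathbb R^n$ is a nonempty compact set, $\hat U$ is a compact metric space, $S$ is a Polish space. The function $f:Y\times\hat U\times S\to\mathbb R^n$ is bounded, continuous in $(y,u)$ on $Y\times\hat U$ and Borel measurable in $s$ on $S$. The $S$-valued random elements $s(0),s(1),\dots$ are independent and identically distributed on a common probability space; $s$ denotes a generic random element with the same distribution, and $E[\varphi(f(y,u,s))]$ is the expectation over $s$ with $(y,u)$ fixed. $U(\cdot)$ is an upper semicontinuous multivalued map from $Y$ to nonempty compact subsets of $\hat U$, and $f(y,u,s)\in Y$ for all $y\in Y$, $u\in U(y)$, $s\in S$. $G:=\{(y,u): y\in Y,\ u\in U(y)\}$ (a compact set). $\Pi$ is the set of control plans $\pi=\{\pi_t(\cdot)\}_{t=0,1,\dots}$, where each $\pi_t:Y\to\hat U$ is Borel measurable with $\pi_t(y)\in U(y)$ for all $y\in Y$. For $\pi\in\Pi$ and $y_0\in Y$, the state-control trajectory $(y^{\pi,y_0}(\cdot),u^{\pi,y_0}(\cdot))$ is defined by $y(0)=y_0$, $u(t)=\pi_t(y(t))$, $y(t+1)=f(y(t),u(t),s(t))$. The function $k:Y\times\hat U\to\mathbb R$ is continuous (hence bounded). For $T=1,2,\dots$, $v_T(y_0):=\frac1T\min_{\pi\in\Pi}E[\sum_{t=0}^{T-1}k(y^{\pi,y_0}(t),u^{\pi,y_0}(t))]$.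 Periodic regimes. For given $y_0\in Y$, a control plan $\pi\in\Pi$ is periodic regime generating (PRG) if there exist integers $T_0\ge0$ and $\mathcal T>0$ such that, for any continuous $q(y,u)$, $E[q(y^{\pi,y_0}(t),u^{\pi,y_0}(t))]=E[q(y^{\pi,y_0}(t+\mathcal T),u^{\pi,y_0}(t+\mathcal T))]$ for all $t\ge T_0$. $\Pi_{per}(y_0)\subset\Pi$ is the set of all PRG control plans (for $y_0$), and $$V_{per}(y_0):=\inf_{\pi\in\Pi_{per}(y_0)}\Big\{\lim_{T\to\infty}\frac1TE\Big[\sum_{t=0}^{T-1}k(y^{\pi,y_0}(t),u^{\pi,y_0}(t))\Big]\Big\}.$$ Augmented problem and dual. $\mathcal P(G)$ and $\mathcal M_+(G)$ are the sets of probability and finite nonnegative measures on Borel subsets of $G$; $C(Y)$ is the space of continuous functions on $Y$. $W:=\{\gamma\in\mathcal P(G): \int_G(E[\varphi(f(y,u,s))]-\varphi(y))\gamma(dy,du)=0\ \forall\varphi\in C(Y)\}$. $\Omega(y_0)$ is the set of $(\gamma,\xi)\in\mathcal P(G)\times\mathcal M_+(G)$ such that $\gamma\in W$ and $\int_G(\varphi(y_0)-\varphi(y))\gamma(dy,du)+\int_G(E[\varphi(f(y,u,s))]-\varphi(y))\xi(dy,du)=0$ for all $\varphi\in C(Y)$; $k^*(y_0):=\inf_{(\gamma,\xi)\in\Omega(y_0)}\int_Gk(y,u)\gamma(dy,du)$. Infimum over the empty set is $+\infty$. $d^*(y_0)$ is the supremum of $\mu$ over all triplets $(\mu,\psi,\eta)\in\mathbb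 R\times C(Y)\times C(Y)$ such that for all $(y,u)\in G$: $k(y,u)+(\psi(y_0)-\psi(y))+E[\eta(f(y,u,s))]-\eta(y)-\mu\ge0$ and $E[\psi(f(y,u,s))]-\psi(y)\ge0$. *)

(* Defs.v *)
From HB Require Import structures.
From mathcomp Require Import all_boot all_order all_algebra finmap.
From mathcomp Require Import all_classical all_reals all_analysis.

Set Implicit Arguments.
Unset Strict Implicit.
Unset Printing Implicit Defensive.

Import Order.TTheory GRing.Theory Num.Theory.
Import numFieldNormedType.Exports.

Local Open Scope classical_set_scope.
Local Open Scope ring_scope.

(* Measurable types are pointed in the library, so a metric space carrying its
   Borel sigma-algebra has to be pointed as well. *)
#[short(type="pointedMetricType")]
HB.structure Definition PointedMetric (K : numDomainType) :=
  { M of Metric K M & Pointed M }.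

Notation borelType T := (g_sigma_algebraType (@open T)).

(* Separable, with topology induced by some complete metric. *)
Definition polish_space (R : realType) (S : topologicalType) : Prop :=
  (exists2 D : set S, countable D & dense D) /\
  exists dist : S -> S -> R,
    [/\ forall x y, dist x y = 0 <-> x = y,
        forall x y, dist x y = dist y x,
        forall x y z, dist x z <= dist x y + dist y z,
        forall (x : S) (A : set S),
          nbhs x A <-> exists2 e, 0 < e & [set y | dist x y < e] `<=` A
      & forall a : nat -> S,
          (forall e, 0 < e ->
             exists N, forall i j, (N <= i)%N -> (N <= j)%N ->
               dist (a i) (a j) < e) ->
          exists x : S, a @ \oo --> x].

Definition usc_on (X T : topologicalType) (A : set X) (F : X -> set T) : Prop :=
  forall x, A x -> forall V : set T, open V -> F x `<=` V ->
    \forall x' \near x, A x' -> F x' `<=` V.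

Definition mutually_independent (R : realType) (d d' : measure_display)
    (Om : measurableType d) (S : measurableType d') (P : probability Om R)
    (I : choiceType) (X : I -> Om -> S) : Prop :=
  forall (J : {fset I}) (B : I -> set S), (forall j, measurable (B j)) ->
    P (\bigcap_(j in [set` J]) (X j @^-1` B j)) =
    \big[*%E/1%E]_(j <- J) P (X j @^-1` B j).

Definition identically_distributed (R : realType) (d d' : measure_display)
    (Om : measurableType d) (S : measurableType d') (P : probability Om R)
    (I : Type) (X : I -> Om -> S) : Prop :=
  forall (i j : I) (B : set S), measurable B ->
    P (X i @^-1` B) = P (X j @^-1` B).

(* Functions on Y (or on Y x Uhat) are represented by functions on the whole of
   R^n (or of R^n x Uhat) whose values off Y play no role; regularity is only
   required on Y, in the subspace topology. *)
Section ControlModel.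
Context (R : realType) (n : nat) (Uhat : pointedMetricType R)
  (S : ptopologicalType) (d : measure_display) (Om : measurableType d)
  (P : probability Om R) (s : nat -> {RV P >-> borelType S}).
Context (Y : set 'rV[R]_n) (U : 'rV[R]_n -> set Uhat)
  (f : 'rV[R]_n * Uhat -> S -> 'rV[R]_n) (k : 'rV[R]_n * Uhat -> R).

Definition graphG : set ('rV[R]_n * Uhat) := [set z | Y z.1 /\ U z.1 z.2].

Definition plan : Type := nat -> 'rV[R]_n -> Uhat.

Definition plans : set plan :=
  [set pi | forall t : nat,
     @measurable_fun _ _ (borelType 'rV[R]_n) (borelType Uhat) Y (pi t) /\
     forall y, Y y -> U y (pi t y)].

Fixpoint state (pi : plan) (y0 : 'rV[R]_n) (t : nat) (w : Om) : 'rV[R]_n :=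
  if t is t'.+1 then
    let y := state pi y0 t' w in f (y, pi t' y) (s t' w)
  else y0.

Definition traj (pi : plan) (y0 : 'rV[R]_n) (t : nat) (w : Om) :
    'rV[R]_n * Uhat :=
  (state pi y0 t w, pi t (state pi y0 t w)).

Definition cost (pi : plan) (y0 : 'rV[R]_n) (T : nat) : \bar R :=
  'E_P[fun w => (\sum_(0 <= t < T) k (traj pi y0 t w))%R]%E.

Definition vT (T : nat) (y0 : 'rV[R]_n) : \bar R :=
  ((T%:R^-1)%:E * ereal_inf [set cost pi y0 T | pi in plans])%E.

Definition prg (y0 : 'rV[R]_n) (pi : plan) : Prop :=
  plans pi /\
  exists T0 period : nat, (0 < period)%N /\
    forall q : 'rV[R]_n * Uhat -> R,
      {within Y `*` [set: Uhat], continuous q} ->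
      forall t, (T0 <= t)%N ->
        ('E_P[fun w => q (traj pi y0 t w)] =
         'E_P[fun w => q (traj pi y0 (t + period) w)])%E.

Definition Vper (y0 : 'rV[R]_n) : \bar R :=
  ereal_inf [set limn (fun T : nat => ((T%:R^-1)%:E * cost pi y0 T)%E)
            | pi in prg y0].

(* E[phi(f(y,u,s))]; all s t have the same law, so s 0 serves as the generic
   random element. *)
Definition meanf (phi : 'rV[R]_n -> R) (z : 'rV[R]_n * Uhat) : \bar R :=
  'E_P[fun w => phi (f z (s 0%N w))]%E.

(* Measures on Borel subsets of G are represented by Borel measures on
   R^n x Uhat that vanish off G. *)
Definition borelYU := borelType ('rV[R]_n * Uhat)%type.

Definition inW (gam : probability borelYU R) : Prop :=
  gam (~` graphG) = 0%E /\
  forall phi : 'rV[R]_n -> R, {within Y, continuous phi} ->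
    (\int[gam]_(z in graphG) (meanf phi z - (phi z.1)%:E) = 0)%E.

Definition inOmega (y0 : 'rV[R]_n) (gam : probability borelYU R)
    (xi : {finite_measure set borelYU -> \bar R}) : Prop :=
  [/\ inW gam, xi (~` graphG) = 0%E
    & forall phi : 'rV[R]_n -> R, {within Y, continuous phi} ->
      (\int[gam]_(z in graphG) (phi y0 - phi z.1)%R%:E +
       \int[xi]_(z in graphG) (meanf phi z - (phi z.1)%:E) = 0)%E].

Definition kstar (y0 : 'rV[R]_n) : \bar R :=
  ereal_inf [set x | exists gam xi, inOmega y0 gam xi /\
                       x = (\int[gam]_(z in graphG) (k z)%:E)%E].

Definition dual_feasible (y0 : 'rV[R]_n) (mu : R) (psi eta : 'rV[R]_n -> R) :
    Prop :=
  [/\ {within Y, continuous psi}, {within Y, continuous eta}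
    & forall z, graphG z ->
      (0 <= (k z)%:E + (psi y0 - psi z.1)%R%:E + meanf eta z
            - (eta z.1)%:E - mu%:E)%E /\
      (0 <= meanf psi z - (psi z.1)%:E)%E].

Definition dstar (y0 : 'rV[R]_n) : \bar R :=
  ereal_sup [set mu%:E | mu in
               [set mu | exists psi eta, dual_feasible y0 mu psi eta]].

End ControlModel.

(* Main.v *)
(* Periodic regimes give admissible pairs in Omega(y0): average the laws of the
   trajectory over a period for gamma, and the sums of the earlier laws for xi.
   Hence k* <= V_per = v(y0), and weak duality gives d* <= k*.  It remains to see
   that v(y0) <= d*.

   Take psi = v.  Dynamic programming V_(T+1)(y) = min_u (k + E V_T(f)), with a
   measurable selection of minimisers, gives V_T/T = v_T, hence E v(f) >= v on G,
   and eta_N = (V_0 + ... + V_(N-1))/N satisfies k - v + E eta_N(f) - eta_N >=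
   v_N - v, where the right-hand side tends to 0 pointwise only and eta_N is only
   lower semicontinuous.  An elementary convexity argument (Simons' inequality)
   repairs both defects: for bounded lower semicontinuous functions on a compact
   set with pointwise liminf >= 0, some convex combination is uniformly >= -e.
   Applied on Y to v_N - v it yields a lower semicontinuous eta, and applied on G
   to continuous functions increasing to this eta it yields a continuous one, so
   that (v(y0) - e, v, eta) is feasible for every e > 0. *)

Require Import Defs.
From HB Require Import structures.
From mathcomp Require Import all_boot all_order all_algebra finmap.
From mathcomp Require Import all_classical all_reals all_analysis.
From mathcomp Require Import measurable_realfun zify lra ring.

Set Implicit Arguments.
Unset Strict Implicit.
Unset Printing Implicit Defensive.

Import Order.TTheory GRing.Theory Num.Theory.
Import numFieldNormedType.Exports.

Local Open Scope classical_set_scope.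
Local Open Scope ring_scope.

(** * Lower semicontinuous functions *)

(** Lower semicontinuity is the natural class because [U] is only upper semicontinuous: minimising
    over [U y] preserves lower semicontinuity but may destroy continuity. A feasible [eta] must
    nevertheless be continuous. Replacing a lower semicontinuous [eta] by continuous [h N]
    increasing to it is beyond Dini's theorem, since in the constraint the mean of [h N] increases
    while [- h N] decreases, so the slack is not monotone in [N]. This forces the second use of the
    convexity argument, on [G]. The other obstacle is measurability. [f] is continuous in [(y, u)]
    and Borel in [s] separately, and the trajectory and the noise live on an abstract probability
    space. Expectations of [phi (f (traj t) (s t))] are therefore computed by approximating [traj t]
    by Borel maps with finitely many values in [G]. Independence is then used only for events, and
    bounded convergence does the rest, first for continuous [phi] and then for monotone limits of
    such functions. *)

Section Topology.
Context {R : realType}.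

Lemma within_continuousP (T : topologicalType) (A : set T) (g : T -> R) :
  {within A, continuous g} <->
  forall x, A x -> forall e, 0 < e ->
    \forall y \near x, A y -> `|g x - g y| < e.
Proof.
rewrite subspace_continuousP; split=> cg x Ax.
  move=> e e0; have /cvgrPdist_lt/(_ e e0) := cg x Ax.
  by rewrite near_withinE.
by apply/cvgrPdist_lt => e e0; rewrite near_withinE; exact: cg.
Qed.

Definition lsc_on (T : topologicalType) (A : set T) (g : T -> R) :=
  forall x, A x -> forall a, a < g x -> \forall y \near x, A y -> a < g y.

Lemma continuous_lsc (T : topologicalType) (A : set T) (g : T -> R) :
  {within A, continuous g} -> lsc_on A g.
Proof.
move=> /within_continuousP cg x Ax a ag.
have := cg x Ax (g x - a); rewrite subr_gt0 => /(_ ag).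
apply: filterS => y /[apply] H.
by have := ler_norm (g x - g y); lra.
Qed.

Lemma lsc_onD (T : topologicalType) (A : set T) (f g : T -> R) :
  lsc_on A f -> lsc_on A g -> lsc_on A (fun x => f x + g x).
Proof.
move=> lf lg x Ax a afg; pose e := (f x + g x - a) / 2.
have e0 : 0 < e by rewrite /e; lra.
have H1 : f x - e < f x by lra.
have H2 : g x - e < g x by lra.
have := lg x Ax _ H2; have := lf x Ax _ H1.
apply: filterS2 => y {}H1 {}H2 Ay.
by move: (H1 Ay) (H2 Ay); rewrite /e; lra.
Qed.

Lemma lsc_onZ (T : topologicalType) (A : set T) (c : R) (g : T -> R) :
  0 <= c -> lsc_on A g -> lsc_on A (fun x => c * g x).
Proof.
rewrite le_eqVlt => /predU1P[<- _ x Ax a|c0 lg x Ax a].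
  by rewrite mul0r => a0; apply: nearW => y _; rewrite mul0r.
rewrite mulrC -ltr_pdivrMr// => ag.
by have := lg x Ax _ ag; apply: filterS => y /[apply]; rewrite ltr_pdivrMr// mulrC.
Qed.

Lemma lsc_on_uniform (T : topologicalType) (A : set T) (g : T -> R) :
  (forall e, 0 < e -> exists2 h, lsc_on A h &
     forall x, A x -> `|h x - g x| <= e) -> lsc_on A g.
Proof.
move=> gh x Ax a ag; pose e := (g x - a) / 3.
have e0 : 0 < e by rewrite /e; lra.
have [h lh hg] := gh e e0.
have : a + e < h x.
  by have := hg x Ax; rewrite ler_norml => /andP[+ _]; rewrite /e; lra.
move=> /(lh x Ax); apply: filterS => y /[swap] Ay /(_ Ay).
by have := hg y Ay; rewrite ler_norml => /andP[_ +]; lra.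
Qed.

Lemma lsc_on_closed (T : topologicalType) (A : set T) (g : T -> R) (r : R) :
  closed A -> lsc_on A g -> closed (A `&` [set x | g x <= r]).
Proof.
move=> cA lg x clx.
have Ax : A x by apply: cA => B /clx [y [[]]]; exists y.
split=> //=; rewrite leNgt; apply/negP => /(lg x Ax) /clx [y [[Ay]]] /= gy.
by move=> /(_ Ay); rewrite ltNge gy.
Qed.

(** Without a minimum, every [x] in [K] has some [y] in [K] with [g y < g x], and this persists near
    [x]. Along the filter of lower rays [a <= g y], compactness yields a single [y] in [K] with
    [g y] below all values on [K], its own included. *)
Lemma lsc_on_min (T : topologicalType) (K : set T) (g : T -> R) :
  compact K -> K !=set0 -> lsc_on K g ->
  exists2 x, K x & forall y, K y -> g x <= g y.
Proof.
move=> cK [z Kz] lg; apply: contrapT => nmin.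
have no x : K x -> exists2 y, K y & g y < g x.
  move=> Kx; apply: contrapT => nx; apply: nmin; exists x => // y Ky.
  by rewrite leNgt; apply/negP => yx; apply: nx; exists y.
pose F := filter_from K (fun y => [set a | a <= g y]).
have FF : ProperFilter F.
  apply: filter_from_proper; last by move=> y _; exists (g y) => /=.
  apply: filter_from_filter; first by exists z.
  move=> i j Ki Kj; have [ij|ji] := leP (g i) (g j).
    by exists i => // a /= ai; split => //=; exact: le_trans ij.
  by exists j => // a /= aj; split => //=; exact: le_trans (ltW ji).
have /compact_near_coveringP/near_covering_withinP := cK.
move=> /(_ _ F (fun a x => a < g x)) H.
have [|y Ky /(_ (g y) (lexx _) y Ky)] := H; last by rewrite /= ltxx.
move=> x Kx; have [y Ky yx] := no x Kx.
exists ([set x' | K x' -> g y < g x'], [set a | a <= g y]).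
  by split => /=; [exact: lg|exists y].
by move=> [x' a] [/= H1 H2] /H1; exact: le_lt_trans.
Qed.

Lemma within_continuous_bounded (T : topologicalType) (K : set T) (g : T -> R) :
  compact K -> {within K, continuous g} -> exists M, forall x, K x -> `|g x| <= M.
Proof.
move=> cK cg; have [K0|nK0] := pselect (K !=set0); last first.
  by exists 0 => x Kx; exfalso; apply: nK0; exists x.
have cN : {within K, continuous (fun x => - g x)}.
  by move=> x; apply: cvgN; exact: cg.
have [a _ aP] := lsc_on_min cK K0 (continuous_lsc cg).
have [b _ bP] := lsc_on_min cK K0 (continuous_lsc cN).
exists (Num.max (g b) (- g a)) => x Kx.
by apply/ler_normlP; rewrite !le_max; have := bP x Kx; rewrite !lerN2 => ->;
  rewrite aP ?orbT.
Qed.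

End Topology.

(** * Simons' inequality *)

Section Simons.
Context {R : realType} {T : topologicalType}.
(** [C n] plays the role of the convex hull of the tail of a sequence from index [n] on. Midpoints
    are enough because the series built below has weights that are powers of one half. *)
Variables (K : set T) (B : R) (C : nat -> set (T -> R)).
Hypotheses (cK : compact K) (K0 : K !=set0).
Hypothesis C_decr : forall n, C n.+1 `<=` C n.
Hypothesis C_mid : forall n g h, C n g -> C n h ->
  C n (fun x => (g x + h x) / 2).
Hypothesis C_bnd : forall g x, C 0%N g -> K x -> `|g x| <= B.
Hypothesis C_lsc : forall g, C 0%N g -> lsc_on K g.
Hypothesis C_nonempty : forall n, C n !=set0.

Let c : R := 2^-1.
Let c0 : 0 < c. Proof. by rewrite invr_gt0. Qed.

Let cn_gt0 n : 0 < c ^+ n. Proof. by rewrite exprn_gt0. Qed.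
Let cn_ge0 n : 0 <= c ^+ n. Proof. exact: ltW. Qed.

Let scale n (q r : R) : `|q| <= r -> `|c ^+ n * q| <= c ^+ n * r.
Proof. by move=> qr; rewrite normrM (ger0_norm (cn_ge0 _)) ler_wpM2l. Qed.

Let C_sub n : C n `<=` C 0%N.
Proof. by elim: n => // n IH g /C_decr /IH. Qed.

(** The best lower bound over [C n] is a supremum that need not be attained; the bounds on [w] and
    on [C 0] make it finite, so it can be approached within [e]. *)
Let near_best n (w : T -> R) (a e : R) : (exists D, forall x, K x -> `|w x| <= D) ->
  0 < e -> 0 <= a ->
  exists2 h, C n h & forall g t, C n g -> (forall x, K x -> t <= w x + a * g x) ->
    forall x, K x -> t - e <= w x + a * h x.
Proof.
move=> [D wD] e0 a0; have [z Kz] := K0; have [g0 Cg0] := C_nonempty n.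
pose E := [set t | exists2 g, C n g & forall x, K x -> t <= w x + a * g x].
have supE : has_sup E.
  split.
    exists (- D - a * B), g0 => // x Kx.
    have := wD x Kx; have := C_bnd (C_sub Cg0) Kx.
    rewrite !ler_norml => /andP[H1 _] /andP[H2 _].
    have := ler_wpM2l a0 H1; lra.
  exists (D + a * B) => t [g Cg] /(_ z Kz).
  have := wD z Kz; have := C_bnd (C_sub Cg) Kz.
  rewrite !ler_norml => /andP[_ H1] /andP[_ H2].
  have := ler_wpM2l a0 H1; lra.
have [t [h Ch ht] et] := sup_adherent e0 supE.
exists h => // g t' Cg gt' x Kx.
have : t' <= sup E by apply: ub_le_sup; [exact: supE.2|exists g].
have := ht x Kx; lra.
Qed.

(* The convexity argument behind Simons' inequality: [g n] almost maximises the
   minimum of [w n + 2^-n g] over [C n], and everything is read off at a point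
   where the limit of [w] attains its minimum. *)
Lemma simons :
  (forall x e, K x -> 0 < e -> exists n, forall g, C n g -> - e <= g x) ->
  forall e, 0 < e -> exists2 g, C 0%N g & forall x, K x -> - e <= g x.
Proof.
move=> Hpt e e0; pose d := e / 8; have d0 : 0 < d by rewrite /d; lra.
have [z Kz] := K0.
(* Boundedness of [w] is a premise so that [choice] applies to all pairs; [w_bnd] discharges it for
   the [w n] that occur. *)
pose ok n (w h : T -> R) := (exists D, forall x, K x -> `|w x| <= D) ->
  C n h /\ forall g t, C n g -> (forall x, K x -> t <= w x + c ^+ n * g x) ->
    forall x, K x -> t - d * c ^+ n * c ^+ n <= w x + c ^+ n * h x.
have /choice[next nextP] : forall p : nat * (T -> R), exists h, ok p.1 p.2 h.
  move=> [n w]; have [wD|nwD] := pselect (exists D, forall x, K x -> `|w x| <= D).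
    have dn : 0 < d * c ^+ n * c ^+ n by rewrite !mulr_gt0// exprn_gt0.
    by have [h Ch hP] := near_best n wD dn (cn_ge0 n); exists h.
  by exists (fun=> 0) => /nwD.
(* [w n] is a partial sum with weights [c ^+ i.+1], [i < n]; the weight not yet spent is [c ^+ n],
   and [u n] below spends all of it on [g n]. *)
pose w := fix w n : T -> R := if n is m.+1
  then fun x => w m x + c ^+ m.+1 * next (m, w m) x else fun=> 0.
pose g n := next (n, w n).
have wS n x : w n.+1 x = w n x + c ^+ n.+1 * g n x by [].
have w_bnd n : exists D, forall x, K x -> `|w n x| <= D.
  elim: n => [|n [D IH]]; first by exists 0 => x _; rewrite normr0.
  have [Cg _] := nextP (n, w n) (ex_intro _ D IH).
  exists (D + c ^+ n.+1 * B) => x Kx;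
    rewrite wS (le_trans (ler_normD _ _))// lerD// ?IH//.
  apply: scale.
  exact: C_bnd (C_sub Cg) Kx.
have gC n : C n (g n) by have [] := nextP (n, w n) (w_bnd n).
have gB n x : K x -> `|g n x| <= B by move=> Kx; exact: C_bnd (C_sub (gC n)) Kx.
have gP n := (nextP (n, w n) (w_bnd n)).2.
pose u n x := w n x + c ^+ n * g n x.
(* Since [c ^+ n] is twice [c ^+ n.+1], what [u (n + m)] adds to [w n] is [c ^+ n] times an iterated
   midpoint of elements of [C n]. *)
have tele m n : exists2 h, C n h &
    forall x, w n x + c ^+ n * h x = u (n + m)%N x.
  elim: m n => [|m IH] n; first by exists (g n) => // x; rewrite addn0.
  have [h Ch hP] := IH n.+1; exists (fun x => (g n x + h x) / 2).
    by apply: C_mid => //; exact: C_decr.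
  move=> x; rewrite addnS -addSn -hP wS exprS /c; lra.
have B0 : 0 <= B by have := gB 0%N z Kz; exact: le_trans (normr_ge0 _).
have wB m n x : K x -> `|w (n + m)%N x - w n x| <= c ^+ n * B.
  move=> Kx; have Hcn : 0 <= c ^+ (n + m) * B by rewrite mulr_ge0.
  suff : `|w (n + m)%N x - w n x| <= c ^+ n * B - c ^+ (n + m) * B by lra.
  elim: m {Hcn} => [|m]; first by rewrite addn0 !subrr normr0.
  rewrite addnS wS exprS; have := scale (n + m)%N (gB (n + m)%N x Kx).
  rewrite !ler_norml; set p := c ^+ (n + m); rewrite /c.
  by move=> /andP[? ?] /andP[? ?]; apply/andP; split; lra.
(* On [K] the sequence [w n x + c ^+ n * B] is nonincreasing, so this infimum is the limit of
   [w n x], with the explicit error [vw]. *)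
pose v x := inf [set w n x + c ^+ n * B | n in [set: nat]].
have vw n x : K x -> `|v x - w n x| <= c ^+ n * B.
  move=> Kx; have lbv m : lbound [set w i x + c ^+ i * B | i in [set: nat]]
      (w m x - c ^+ m * B).
    move=> _ [i _ <-]; have [mi|/ltnW im] := leqP m i.
      have := wB (i - m)%N m x Kx; rewrite subnKC// ler_norml => /andP[? ?].
      have : 0 <= c ^+ i * B by rewrite mulr_ge0.
      lra.
    have := wB (m - i)%N i x Kx; rewrite subnKC// ler_norml => /andP[? ?].
    have : 0 <= c ^+ m * B by rewrite mulr_ge0.
    lra.
  have H1 : w n x - c ^+ n * B <= v x.
    by apply: lb_le_inf; [exists (w 0%N x + c ^+ 0 * B), 0%N|exact: lbv].
  have H2 : v x <= w n x + c ^+ n * B.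
    by apply: ge_inf; [exists (w 0%N x - c ^+ 0 * B); exact: lbv|exists n].
  by rewrite ler_norml; apply/andP; split; lra.
have uv n x : K x -> `|u n x - v x| <= 2 * (c ^+ n * B).
  move=> Kx; have := vw n x Kx; rewrite /u; have := scale n (gB n x Kx);
    rewrite !ler_norml.
  by move=> /andP[? ?] /andP[? ?]; apply/andP; split; lra.
have small r : 0 < r -> exists n0, forall n, (n0 <= n)%N -> 2 * (c ^+ n * B) <= r.
  move=> r0; have : (fun n => 2 * (c ^+ n * B)) @ \oo --> 2 * (0 * B).
    apply: cvgMr; apply: cvgMl; apply: cvg_expr.
    by rewrite ger0_norm ?ltW// invf_lt1// ltr1n.
  rewrite mul0r mulr0 => /cvgrPdist_le/(_ r r0)[n0 _ H]; exists n0 => n /H/=.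
  by rewrite sub0r normrN; exact: le_trans (ler_norm _).
have wl n : lsc_on K (w n).
  elim: n => [|n IH]; first by apply: continuous_lsc; exact: cst_continuous.
  apply: lsc_onD => //; apply: lsc_onZ; first exact: cn_ge0.
  exact: C_lsc (C_sub (gC n)).
have vl : lsc_on K v.
  apply: lsc_on_uniform => r r0; have [n0 n0P] := small r r0.
  exists (w n0); [exact: wl|move=> x Kx; rewrite distrC].
  apply: le_trans (vw n0 x Kx) _; apply: le_trans (n0P _ (leqnn _)).
  have : 0 <= c ^+ n0 * B by rewrite mulr_ge0.
  lra.
have [b Kb bmin] := lsc_on_min cK K0 vl; set t := v b in bmin.
(* [v], whose minimum is [t], is almost [w n + c ^+ n * h] with [h] in [C n]. So a bound close to
   [t] is available to the competitor [h], and near optimality transfers it to [g n], at [b] in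
   particular. *)
have step n : t - d * c ^+ n * c ^+ n <= u n b.
  apply/ler_addgt0Pr => r r0; have [n0 n0P] := small r r0.
  have [h Ch hP] := tele n0 n.
  have : t - r - d * c ^+ n * c ^+ n <= u n b; last lra.
  apply: (gP n h) => // x Kx; rewrite hP.
  have := uv (n + n0)%N x Kx; have := n0P (n + n0)%N (leq_addl _ _).
  have := bmin x Kx; rewrite ler_norml => ? ? /andP[? _]; lra.
(* Equality holds at [n = 0]. With [p = c ^+ n], [step] bounds the next difference by half the
   present one plus [d * p ^+ 2 / 2]; the terms in [d] are fitted so that the bound reproduces
   itself. *)
have pw n : t - w n b <= c ^+ n * (t + 2 * d - 2 * d * c ^+ n).
  elim: n => [|n IH]; first by rewrite /= expr0; lra.
  have := step n; rewrite /u wS exprS /c => H.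
  have {}H : t - w n b - c ^+ n * g n b <= d * c ^+ n * c ^+ n.
    by move: H; rewrite /c; lra.
  move: IH H; rewrite -/c; set p := c ^+ n; rewrite /c; set q := g n b; set W := w n b.
  nra.
(* [t - w n b] is a limit of values [c ^+ n * h b] with [h] in [C n], so the hypothesis at [b]
   bounds it below by [- d * c ^+ n]. Together with [pw] this gives [t >= - 3 * d], which
   [d = e / 8] keeps above [- e / 2]. *)
have tge : - e / 2 <= t.
  have [n nP] := Hpt b d Kb d0.
  have : - d * c ^+ n <= t - w n b.
    apply/ler_addgt0Pr => r r0; have [n0 n0P] := small r r0.
    have [h Ch hP] := tele n0 n.
    have := uv (n + n0)%N b Kb; have := n0P (n + n0)%N (leq_addl _ _).
    rewrite -hP; have := ler_wpM2l (cn_ge0 n) (nP h Ch).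
    rewrite ler_norml -/t => ? ? /andP[_ ?]; lra.
  move=> /le_trans/(_ (pw n)); rewrite [leLHS]mulrC ler_pM2l//.
  have : 0 < d * c ^+ n by rewrite mulr_gt0.
  rewrite /d; lra.
have e2 : 0 < e / 2 by lra.
(* As [w 0 = 0] and [c ^+ 0 = 1], [u n0] itself is an element of [C 0], and it is uniformly within
   [e / 2] of [v]. *)
have [n0 n0P] := small _ e2; have [h Ch hP] := tele n0 0%N; exists h => // x Kx.
have := hP x; rewrite /= add0r expr0 mul1r add0n => ->.
have := uv n0 x Kx; have := n0P n0 (leqnn _); have := bmin x Kx.
rewrite ler_norml => ? ? /andP[? _]; lra.
Qed.

End Simons.

(** The approximants are Lipschitz regularisations of [g]: a growing penalty on the distance leaves
    only points near [x] in competition, where lower semicontinuity prevents [g] from dropping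
    much. *)
Lemma lsc_monotone_approx (R : realType) (V : normedModType R) (K : set V)
    (g : V -> R) (M : R) :
  K !=set0 -> (forall x, K x -> `|g x| <= M) -> lsc_on K g ->
  exists G : nat -> V -> R,
    [/\ forall m, continuous (G m),
        forall m x, K x -> G m x <= G m.+1 x,
        forall m x, K x -> - M <= G m x <= g x
      & forall x, K x -> G ^~ x @ \oo --> g x].
Proof.
move=> [z Kz] gM lg.
pose E m x := [set g y + m%:R * `|x - y| | y in K].
pose G m x := inf (E m x).
have lbE m x : lbound (E m x) (- M).
  move=> _ [y Ky <-]; have := gM y Ky; rewrite ler_norml => /andP[? _].
  have : 0 <= m%:R * `|x - y| by rewrite mulr_ge0.
  lra.
have E0 m x : E m x !=set0 by exists (g z + m%:R * `|x - z|), z.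
have GE m x y : K y -> G m x <= g y + m%:R * `|x - y|.
  by move=> Ky; apply: ge_inf; [exists (- M); exact: lbE|exists y].
have Gg m x : K x -> G m x <= g x.
  by move=> /(GE m x); rewrite subrr normr0 mulr0 addr0.
have MG m x : - M <= G m x by apply: lb_le_inf.
have Glip m x x' : G m x <= G m x' + m%:R * `|x - x'|.
  rewrite -lerBlDr; apply: lb_le_inf => // _ [y Ky <-].
  rewrite lerBlDr (le_trans (GE m x y Ky))// -addrA lerD2l -mulrDr ler_wpM2l//.
  by have := ler_distD x' x y; lra.
have Gmono m x : G m x <= G m.+1 x.
  apply: lb_le_inf => // _ [y Ky <-]; apply: le_trans (GE m x y Ky) _.
  by rewrite lerD2l ler_wpM2r// ler_nat.
exists G; split => //.
- move=> m x; apply/cvgrPdist_le => e e0.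
  near=> y; have H1 := Glip m x y; have H2 := Glip m y x.
  have : m%:R * `|x - y| <= e.
    have : `|x - y| <= e / m.+1%:R.
      by near: y; apply: cvgr_dist_le; [exact: cvg_id|rewrite divr_gt0].
    rewrite ler_pdivlMr// mulrC; apply: le_trans.
    by rewrite ler_wpM2r// ler_nat.
  move: H2; rewrite (distrC y x) ler_norml => ? ?.
  by apply/andP; split; lra.
- by move=> m x Kx; rewrite MG Gg.
- move=> x Kx; apply/cvgrPdist_le => e e0.
  have [d /= d0 dP] : exists2 d, 0 < d & forall y, `|x - y| < d -> K y -> g x - e < g y.
    have /(lg x Kx) : g x - e < g x by rewrite ltrBlDr ltrDl.
    by move=> /nbhs_normP[d d0 dP]; exists d.
  (* Beyond distance [d] the penalty is then at least [2 * M], which outweighs any drop of a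
     function bounded by [M]. *)
  have [N NP] : exists N : nat, 2 * M <= N%:R * d.
    exists (Num.bound `|2 * M / d|); rewrite -ler_pdivrMr//.
    by apply: le_trans (ler_norm _) _; apply: ltW; exact: archi_boundP.
  exists N => // m /= Nm; have := Gg m x Kx.
  have : g x - e <= G m x.
    apply: lb_le_inf => // _ [y Ky <-].
    have m0 : 0 <= m%:R * `|x - y| by rewrite mulr_ge0.
    have [/dP/(_ Ky)|dy] := ltP `|x - y| d; first lra.
    have : N%:R * d <= m%:R * `|x - y|.
      by apply: ler_pM; rewrite ?ler_nat// ltW.
    have := gM y Ky; have := gM x Kx; rewrite !ler_norml.
    by move=> /andP[? ?] /andP[? ?]; lra.
  by rewrite ler_norml => ? ?; apply/andP; split; lra.
Unshelve. all: by end_near. Qed.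

(** * Borel sets and measurable selection *)

(* The library does not join the pointed and topological structures of products. *)
HB.instance Definition _ (T1 T2 : ptopologicalType) := Pointed.on (T1 * T2)%type.

Notation borel_measurable T := (@measurable _ (borelType T)).

Section Borel.
Context {R : realType}.

Lemma open_borel (T : ptopologicalType) (A : set T) : open A -> borel_measurable T A.
Proof. by move=> oA; exact: sub_sigma_algebra. Qed.

Lemma closed_borel (T : ptopologicalType) (A : set T) :
  closed A -> borel_measurable T A.
Proof.
move=> cA; rewrite -[A]setCK; apply: (@measurableC _ (borelType T)).
by apply: open_borel; exact: closed_openC.
Qed.

Lemma lsc_borel_measurable (T : ptopologicalType) (A : set T) (g : T -> R) :
  closed A -> lsc_on A g -> @measurable_fun _ _ (borelType T) R A g.
Proof.
move=> cA lg; apply: (measurability _ (RGenOInfty.measurableE R)).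
move=> _ [_ [a ->] <-].
have -> : A `&` g @^-1` `]a, +oo[ = A `&` ~` (A `&` [set x | g x <= a]).
  apply/seteqP; split=> x [Ax] /=; rewrite ?in_itv/= ?andbT.
    by move=> ag; split=> // -[_]; rewrite leNgt ag.
  by move=> H; split=> //; rewrite ?in_itv/= ?andbT ltNge; apply/negP => xa; exact: H.
apply: (@measurableI _ (borelType T)); first exact: closed_borel.
by apply: (@measurableC _ (borelType T)); apply: closed_borel; exact: lsc_on_closed.
Qed.

(** Compactness is applied to the filter of finite sequences ordered by inclusion. Interiors are
    taken because the balls need not be open. *)
Lemma compact_net (T : pseudoMetricType R) (K : set T) (e : R) :
  compact K -> 0 < e -> exists s : seq T, (forall a, a \in s -> K a) /\
    forall x, K x -> exists2 a, a \in s & (ball a e)° x.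
Proof.
move=> cK e0.
pose F := filter_from setT (fun s : seq T => [set s' : seq T | {subset s <= s'}]).
have FF : ProperFilter F.
  apply: filter_from_proper; last by move=> s _; exists s => /=.
  apply: filter_from_filter; first by exists [::].
  move=> s1 s2 _ _; exists (s1 ++ s2) => // s' /= ss'.
  by split=> x xs; apply: ss'; rewrite mem_cat xs ?orbT.
have /compact_near_coveringP/near_covering_withinP/(_ _ F (fun s x =>
  exists2 a, (a \in s) && `[< K a >] & (ball a e)° x)) := cK.
case=> [|s _ /(_ s) sP]; last first.
  exists [seq a <- s | `[< K a >]]; split.
    by move=> a; rewrite mem_filter => /andP[/asboolP].
  move=> x Kx; have [|a /andP[ais Ka] ax] := sP _ x Kx; first by [].
  by exists a => //; rewrite mem_filter Ka.
move=> x Kx; exists ((ball x e)°, [set s : seq T | {subset [:: x] <= s}]).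
  split=> /=; last by exists [:: x].
  by apply: open_nbhs_nbhs; split; [exact: open_interior|exact: nbhsx_ballx].
move=> [x' s] [/= xx' xs] _; exists x => //.
by rewrite xs ?mem_head//=; exact/asboolP.
Qed.

Lemma compact_countable_base (T : pseudoMetricType R) (K : set T) :
  compact K -> exists B : nat -> set T, (forall i, open (B i)) /\
    forall O x, open O -> K x -> O x -> exists i, B i x /\ B i `<=` O.
Proof.
move=> cK; have cov n : exists s : seq T, forall x, K x ->
    exists2 z, z \in s & (ball z (n.+1%:R^-1 : R))° x.
  have n0 : 0 < (n.+1%:R^-1 : R) by rewrite invr_gt0.
  by have [s [_ sP]] := compact_net cK n0; exists s.
have /choice[s sP] := cov.
(* [i] encodes the scale of a net and the position of a centre in it; meaningless codes give the
   empty set. *)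
pose B (i : nat) := if (choice.unpickle i : option (nat * nat)) is Some (n, j) then
  (if ohead (drop j (s n)) is Some z then (ball z (n.+1%:R^-1 : R))° else set0) else set0.
exists B; split.
  move=> i; rewrite /B; case: (choice.unpickle i : option (nat * nat)) => [[n j]|];
    last exact: open0.
  by case: ohead => [z|]; [exact: open_interior|exact: open0].
move=> O x oO Kx Ox; have /nbhs_ballP[e /= e0 eO] : nbhs x O by exact: open_nbhs_nbhs.
have e20 : 0 < e / 2 by rewrite divr_gt0.
have [N] := ltr_add_invr e20; rewrite add0r => Ne.
have [z zs zx] := sP N x Kx; exists (choice.pickle (N, index z (s N))).
rewrite /B choice.pickleK (drop_nth z) ?index_mem//= nth_index//; split=> // y zy.
apply: eO; rewrite [e]splitr; apply: (@ball_triangle _ _ z).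
  by apply: (le_ball (ltW Ne)); apply/ball_sym; exact: interior_subset.
by apply: (le_ball (ltW Ne)); exact: interior_subset.
Qed.

(** An open preimage is the countable union of the preimages of the basic sets inside the open set.
    The base condition concerns only values of [X], so a base at the points of a compact set that
    contains them suffices. *)
Lemma measurable_fun_base d (Om : measurableType d) (T : ptopologicalType)
    (D : set Om) (X : Om -> T) (I : countType) (B : I -> set T) :
  (forall O x, open O -> D x -> O (X x) -> exists i, B i (X x) /\ B i `<=` O) ->
  (forall i, measurable (D `&` X @^-1` B i)) ->
  @measurable_fun _ _ Om (borelType T) D X.
Proof.
move=> base mB; apply: (@measurability _ _ Om (borelType T) D X open erefl).
move=> _ [W oW <-].
have -> : D `&` X @^-1` W =
    \bigcup_i [set x | B i `<=` W /\ (D `&` X @^-1` B i) x].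
  apply/seteqP; split=> [x [Dx Wx]|x [i _ [BW [Dx Bx]]]].
    by have [i [Bx BW]] := base W x oW Dx Wx; exists i.
  by split=> //; exact: BW.
apply: countable_bigcupT_measurable => // i.
have [BW|nBW] := pselect (B i `<=` W).
  by rewrite [X in measurable X](_ : _ = D `&` X @^-1` B i)//; apply/seteqP;
    split=> x // [].
by rewrite [X in measurable X](_ : _ = set0)//; apply/seteqP; split=> x // [].
Qed.

Lemma continuous_mdist (T : metricType R) (z : T) : continuous (mdist z).
Proof.
move=> u; apply/cvgrPdist_le => e e0; apply/nbhs_ballP; exists e => //= w.
rewrite ballEmdist/= => uw; have := metric_triangle z u w.
have := metric_triangle z w u; rewrite (metric_sym w u) ler_norml => ? ?.
by apply/andP; split; lra.
Qed.

End Borel.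

Lemma hausdorff_prod (T1 T2 : topologicalType) :
  hausdorff_space T1 -> hausdorff_space T2 -> hausdorff_space (T1 * T2)%type.
Proof.
move=> h1 h2 p q pq; rewrite (surjective_pairing p) (surjective_pairing q).
congr pair; [apply: h1|apply: h2] => A B Ap Bq.
  have [] := pq (A `*` setT) (B `*` setT).
  - by exists (A, setT) => //=; split=> //; exact: filterT.
  - by exists (B, setT) => //=; split=> //; exact: filterT.
  by move=> [x z] [[/= Ax _] [/= Bx _]]; exists x.
have [] := pq (setT `*` A) (setT `*` B).
- by exists (setT, A) => //=; split=> //; exact: filterT.
- by exists (setT, B) => //=; split=> //; exact: filterT.
by move=> [x z] [[/= _ Az] [/= _ Bz]]; exists z.
Qed.

Section Selection.
Context {R : realType} (X : ptopologicalType) (Z : pointedMetricType R).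
Variables (Y : set X) (U : X -> set Z) (Q : X * Z -> R).
Hypotheses (hX : hausdorff_space X) (cY : compact Y) (cZ : compact [set: Z]).
Let G := [set z | Y z.1 /\ U z.1 z.2].
Hypotheses (cG : compact G) (lQ : lsc_on G Q).
Hypothesis U0 : forall y, Y y -> U y !=set0.

(** Measurability of a set-valued map is expressed by Borel hitting sets of closed sets, which suits
    decreasing sequences of compact values. *)
Let hit (A : X -> set Z) (C : set Z) := Y `&` [set y | A y `&` C !=set0].

Let argmin (A : X -> set Z) (q : X -> Z -> R) y : set Z :=
  [set u | A y u /\ forall u', A y u' -> q y u <= q y u'].

Let graph_closed : closed G.
Proof.
by apply: compact_closed => //; apply: hausdorff_prod => //; exact: metric_hausdorff.
Qed.

Let lsc_on_section y : Y y -> lsc_on (U y) (fun u => Q (y, u)).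
Proof.
move=> Yy u Uu a aQ; have [[V W] /= [yV uW] VW] := lQ (conj Yy Uu : G (y, u)) aQ.
apply: filterS uW => u' Wu' Uu'; apply: (VW (y, u')) => //.
by split=> //=; exact: nbhs_singleton.
Qed.

Let graph_fiber_closed y : Y y -> closed (U y).
Proof.
move=> Yy u clu; have [] : G (y, u); last by [].
apply: graph_closed => B [[V W] /= [yV uW] VW].
have [u' [Uu' Wu']] := clu W uW; exists (y, u'); split=> //.
by apply: VW; split=> //=; exact: nbhs_singleton.
Qed.

(** The set is the projection of a compact part of [G], hence closed. *)
Let borel_hitQ C r : closed C ->
  borel_measurable X (Y `&` [set y | exists u, [/\ U y u, C u & Q (y, u) <= r]]).
Proof.
move=> cC; apply: closed_borel.
pose D := (G `&` [set z | Q z <= r]) `&` (snd @^-1` C).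
have -> : Y `&` [set y | exists u, [/\ U y u, C u & Q (y, u) <= r]] = fst @` D.
  apply/seteqP; split=> [y [Yy [u [Uu Cu Qu]]]|_ [[y u] [[[/= Yy Uu] Qu] Cu] <-]].
    by exists (y, u).
  by split=> //; exists u.
apply: compact_closed => //; apply: continuous_compact.
  by apply: continuous_subspaceT => z; exact: cvg_fst.
apply: (subclosed_compact _ cG); last by move=> z [[]].
apply: closedI; first exact: lsc_on_closed.
by apply: closed_comp => // z _; exact: cvg_snd.
Qed.

(** The input concerns sublevel sets of [q], the output plain hitting sets. When [q] does not depend
    on [y], its sublevel set can be absorbed into [C], so the output feeds the next step. *)
Let argmin_step (A : X -> set Z) (q : X -> Z -> R) :
  (forall y, Y y -> closed (A y)) -> (forall y, Y y -> A y !=set0) ->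
  (forall y, Y y -> lsc_on (A y) (q y)) ->
  (forall C r, closed C -> borel_measurable X
    (Y `&` [set y | exists u, [/\ A y u, C u & q y u <= r]])) ->
  [/\ forall y, Y y -> closed (argmin A q y),
      forall y, Y y -> argmin A q y !=set0
    & forall C, closed C -> borel_measurable X (hit (argmin A q) C)].
Proof.
move=> cA A0 lq mq.
have cAC y C : Y y -> closed C -> compact (A y `&` C).
  by move=> Yy cC; apply: (subclosed_compact _ cZ) => //; apply: closedI => //;
    exact: cA.
have minP y : Y y -> exists2 u, A y u & forall u', A y u' -> q y u <= q y u'.
  move=> Yy; have cAy : compact (A y) by rewrite -[A y]setIT; exact: cAC closedT.
  exact: lsc_on_min cAy (A0 _ Yy) (lq _ Yy).
split.
- move=> y Yy; have [u Au uP] := minP y Yy.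
  have -> : argmin A q y = A y `&` [set u' | q y u' <= q y u].
    apply/seteqP; split=> u' [Au' u'P]; split=> //=; first exact: u'P.
    by move=> w /uP; exact: le_trans.
  by apply: lsc_on_closed; [exact: cA|exact: lq].
- by move=> y /minP [u Au uP]; exists u.
move=> C cC.
pose H C r := Y `&` [set y | exists u, [/\ A y u, C u & q y u <= r]].
(* The argmin misses [C] exactly when a rational separates the minimum of [q y] over [A y] from its
   minimum over the part of [A y] in [C]; the latter is attained by compactness, unless that part is
   empty. *)
have -> : hit (argmin A q) C =
    Y `\` \bigcup_(r : rat) (H setT (ratr r) `\` H C (ratr r)).
  apply/seteqP; split=> [y [Yy [u [[Au uP] Cu]]]|y [Yy Hy]].
    split=> // -[r _ [[_ [w [Aw _ wr]]]]]; apply; split=> //; exists u; split=> //.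
    by apply: le_trans wr; exact: uP.
  split=> //; have [m Am mP] := minP y Yy.
  have HC r : q y m <= ratr r -> H C (ratr r) y.
    move=> mr; apply: contrapT => nH; apply: Hy; exists r => //; split=> //.
    by split=> //; exists m.
  have [r mr] : exists r : rat, q y m <= ratr r.
    have /rat_in_itvoo[r] : q y m < q y m + 1 by rewrite ltrDl.
    by rewrite in_itv/= => /andP[/ltW mr _]; exists r.
  have [_ [w0 [Aw0 Cw0 _]]] := HC r mr.
  have [||w [Aw Cw] wP] := @lsc_on_min R _ (A y `&` C) (q y) (cAC y C Yy cC).
  - by exists w0.
  - move=> x [Ax _] a /(lq _ Yy _ Ax); apply: filterS => x' Hx' [Ax' _].
    exact: Hx'.
  exists w; split=> //; split=> // u Au; apply: le_trans (mP u Au).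
  rewrite leNgt; apply/negP => /rat_in_itvoo [r' ].
  rewrite in_itv/= => /andP[/ltW/HC [_ [w' [Aw' Cw' w'r]]]].
  by rewrite ltNge (le_trans _ w'r)// wP.
apply: (@measurableD _ (borelType X)).
  by apply: closed_borel; exact: compact_closed.
apply: (@bigcupT_measurable_rat _ (borelType X)) => r.
apply: (@measurableD _ (borelType X)); last exact: mq.
exact: mq closedT.
Qed.

(** Points picked from a countable base are dense. One that is closer to [u] than half the distance
    from [u] to [u'] cannot be equidistant from both. *)
Lemma separating_sequence :
  exists a : nat -> Z, forall u u', (forall i, mdist (a i) u = mdist (a i) u') ->
    u = u'.
Proof.
have [B [oB BP]] := compact_countable_base cZ.
exists (fun i => xget point (B i)) => u u' H.
apply: mdist_positivity; apply/eqP; rewrite eq_le mdist_ge0 andbT leNgt.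
apply/negP => d0; have d20 : 0 < mdist u u' / 2 by rewrite divr_gt0.
have [i [Bu BO]] := BP (ball u (mdist u u' / 2))° u (@open_interior _ _) I
  (nbhsx_ballx _ _ d20).
have /BO/interior_subset := @xgetPex _ point (B i) (ex_intro _ u Bu).
rewrite ballEmdist/=; have := H i; set a := xget _ _ => au ua.
have := metric_triangle u a u'; rewrite -au (metric_sym a u); lra.
Qed.

(* Lexicographic minimisation: first [Q], then the distances to the points of a
   separating sequence; the successive argmin sets shrink to a singleton. *)
Lemma measurable_argmin : exists sel : X -> Z,
  @measurable_fun _ _ (borelType X) (borelType Z) Y sel /\
  forall y, Y y -> U y (sel y) /\ forall u, U y u -> Q (y, sel y) <= Q (y, u).
Proof.
have [a aP] := separating_sequence.
pose A := fix A n := if n is m.+1 then argmin (A m) (fun _ u => mdist (a m) u)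
  else argmin U (fun y u => Q (y, u)).
have AP n : [/\ forall y, Y y -> closed (A n y), forall y, Y y -> A n y !=set0
    & forall C, closed C -> borel_measurable X (hit (A n) C)].
  elim: n => [|n [cA A0 mA]]; first exact: argmin_step.
  apply: argmin_step => //.
    move=> y Yy; apply: continuous_lsc; apply: continuous_subspaceT;
      exact: continuous_mdist.
  move=> C r cC.
  rewrite [X in measurable X](_ : _ = hit (A n) (C `&` [set u | mdist (a n) u <= r])).
    apply: mA; apply: closedI => //.
    by apply: (@closed_comp _ _ (mdist (a n)) [set t | t <= r]); [move=> u _;
      exact: continuous_mdist|exact: closed_le].
  apply/seteqP; split=> y [Yy [u]]; last by move=> [? [? ?]]; split=> //; exists u.
  by move=> [? ? ?]; split=> //; exists u.
have Asub n m y : A (n + m)%N y `<=` A n y.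
  by elim: m => [|m IH] u; rewrite ?addn0 ?addnS//= => -[/IH].
(* Cantor's intersection argument: nested closed sets in a compact space, each meeting [C], have a
   common point in [C]. *)
have AC y C : Y y -> closed C -> (forall n, A n y `&` C !=set0) ->
    exists u, C u /\ forall n, A n y u.
  move=> Yy cC AnC; apply: contrapT => nu.
  have /compact_near_coveringP/(_ _ \oo (fun n u => ~ (A n y u /\ C u))) := cZ.
  case=> [|N _ NP]; last first.
    by have [u [Au Cu]] := AnC N; apply: (NP N (leqnn N) u I).
  move=> u _; have [N Nu] : exists N, ~ (A N y `&` C) u.
    apply: contrapT => H; apply: nu; exists u; split.
      by apply: contrapT => nC; apply: H; exists 0%N => -[].
    by move=> n; apply: contrapT => nA; apply: H; exists n => -[].
  exists (~` (A N y `&` C), [set n | (N <= n)%N]); last first.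
    move=> [u' n] [/= Nu' Nn] [Au' Cu']; apply: Nu'; split=> //.
    by apply: (@Asub N (n - N)%N); rewrite subnKC.
  split=> /=; last by exists N.
  apply: open_nbhs_nbhs; split=> //; apply: closed_openC; apply: closedI => //.
  by have [+ _ _] := AP N; exact.
have Auniq y u u' : (forall n, A n y u) -> (forall n, A n y u') -> u = u'.
  move=> Au Au'; apply: aP => i; have [/= Aiu ui] := Au i.+1; have [/= Aiu' u'i] :=
    Au' i.+1.
  by apply/eqP; rewrite eq_le ui// u'i.
have /choice[sel selP] y : exists u, Y y -> forall n, A n y u.
  have [Yy|nYy] := pselect (Y y); last by exists point.
  have [|u [_ Au]] := AC y setT Yy closedT; last by exists u.
  by move=> n; have [_ /(_ y Yy)[u Au] _] := AP n; exists u.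
exists sel; split; last by move=> y /selP/(_ 0%N)[].
apply: (@measurability _ _ (borelType X) (borelType Z) Y sel open erefl).
move=> _ [W oW <-].
have mY : borel_measurable X Y by apply: closed_borel; exact: compact_closed.
(* The intersection of the [A n y] is the singleton of [sel y], so [sel y] is outside [W] iff every
   [A n y] meets the complement of [W]. *)
have -> : Y `&` sel @^-1` W = Y `\` \bigcap_n hit (A n) (~` W).
  apply/seteqP; split=> [y [Yy Wy]|y [Yy Hy]]; split=> //.
    move=> H; have [|u [nWu Au]] := AC y (~` W) Yy (open_closedC oW).
      by move=> n; have [] := H n I.
    by apply: nWu; rewrite (Auniq y u (sel y))//; exact: selP.
  apply: contrapT => nW; apply: Hy => n _; split=> //; exists (sel y).
  by split=> //; exact: selP.
apply: (@measurableD _ (borelType X)) => //.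
apply: (@bigcapT_measurable _ (borelType X)) => n.
by have [_ _ +] := AP n; apply; exact: open_closedC.
Qed.

End Selection.

(** * Bounded measurable functions *)

Section BoundedMeasurable.
Context {R : realType} {d : measure_display} {T : measurableType d}.

(** On a measurable set these functions are integrable for every finite measure, so the integrals
    below can be real numbers. *)
Definition bounded_measurable (D : set T) (g : T -> R) :=
  measurable_fun D g /\ exists M, forall x, D x -> `|g x| <= M.

Lemma bounded_measurableD D f g : bounded_measurable D f ->
  bounded_measurable D g -> bounded_measurable D (fun x => f x + g x).
Proof.
move=> [mf [M fM]] [mg [N gN]]; split; first exact: measurable_funD.
by exists (M + N) => x Dx; rewrite (le_trans (ler_normD _ _))// lerD ?fM ?gN.
Qed.

Lemma bounded_measurableZ D c g :
  bounded_measurable D g -> bounded_measurable D (fun x => c * g x).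
Proof.
move=> [mg [M gM]]; split; first by apply: measurable_funM => //; exact: measurable_cst.
by exists (`|c| * M) => x Dx; rewrite normrM ler_wpM2l// gM.
Qed.

Lemma bounded_measurableB D f g : bounded_measurable D f ->
  bounded_measurable D g -> bounded_measurable D (fun x => f x - g x).
Proof.
move=> bf bg; have := bounded_measurableD bf (bounded_measurableZ (-1) bg).
by under eq_fun do rewrite mulN1r.
Qed.

Lemma bounded_measurable_cst D (c : R) : bounded_measurable D (fun=> c).
Proof. by split; [exact: measurable_cst|exists `|c|]. Qed.

Lemma bounded_measurable_sum D (I : Type) (s : seq I) (g : I -> T -> R) :
  (forall i, bounded_measurable D (g i)) ->
  bounded_measurable D (fun x => \sum_(i <- s) g i x).
Proof.
move=> bg; elim: s => [|i s IH].
  by under eq_fun do rewrite big_nil; exact: bounded_measurable_cst.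
by under eq_fun do rewrite big_cons; exact: bounded_measurableD.
Qed.

Lemma bounded_measurable_integrable (mu : {finite_measure set T -> \bar R}) D g :
  measurable D -> bounded_measurable D g -> mu.-integrable D (EFin \o g).
Proof.
move=> mD [mg [M gM]]; apply: measurable_bounded_integrable => //.
  by rewrite ltey_eq fin_num_measure.
exists M; split; first exact: num_real.
by move=> N MN x Dx; apply: le_trans (gM x Dx) (ltW MN).
Qed.

Lemma integral_bounded_measurable (mu : {finite_measure set T -> \bar R}) D g :
  measurable D -> bounded_measurable D g ->
  (\int[mu]_(x in D) (g x)%:E)%E = (\int[mu]_(x in D) g x)%:E.
Proof.
move=> mD bg; rewrite /Rintegral fineK//; apply: integrable_fin_num => //.
exact: bounded_measurable_integrable.
Qed.

Lemma expectation_bounded_measurable (P : probability T R) g :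
  bounded_measurable setT g -> ('E_P[g] = (\int[P]_x g x)%:E)%E.
Proof. by move=> bg; rewrite unlock integral_bounded_measurable. Qed.

Lemma cvg_Rintegral (mu : {finite_measure set T -> \bar R}) D (g_ : nat -> T -> R) g M :
  measurable D -> (forall n, measurable_fun D (g_ n)) ->
  (forall n x, D x -> `|g_ n x| <= M) ->
  (forall x, D x -> g_ ^~ x @ \oo --> g x) ->
  (fun n => \int[mu]_(x in D) g_ n x) @ \oo --> \int[mu]_(x in D) g x.
Proof.
move=> mD mg gM cg.
have mg' : measurable_fun D g by exact: measurable_fun_cvg cg.
have gM' x : D x -> `|g x| <= M.
  move=> Dx; have cn : (fun n => `|g_ n x|) @ \oo --> `|g x|.
    by apply: cvg_norm; exact: cg.
  rewrite -(cvg_lim _ cn)//; apply: limr_le; first by apply/cvg_ex; exists `|g x|.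
  by apply: nearW => n; exact: gM.
have bg : bounded_measurable D g by split=> //; exists M.
have bgn n : bounded_measurable D (g_ n).
  by split=> //; exists M => x; exact: gM.
apply: (@fine_cvg R); rewrite fineK; last first.
  by apply: integrable_fin_num => //; exact: bounded_measurable_integrable.
apply: (@dominated_cvg _ _ _ mu D mD (fun n x => (g_ n x)%:E) (EFin \o g) (cst M%:E)) => //.
- by move=> n; apply/measurable_EFinP.
- by move=> x Dx; apply: cvg_EFin; [exact: nearW|exact: cg].
- apply: (@bounded_measurable_integrable mu D (cst M)) => //.
  exact: bounded_measurable_cst.
Qed.

Lemma Rintegral_bounded_sum (mu : {finite_measure set T -> \bar R}) D
    (I : Type) (s : seq I) (g : I -> T -> R) :
  measurable D -> (forall i, bounded_measurable D (g i)) ->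
  \int[mu]_(x in D) (\sum_(i <- s) g i x) = \sum_(i <- s) \int[mu]_(x in D) g i x.
Proof.
move=> mD bg; elim: s => [|i s IH].
  by under eq_Rintegral do rewrite big_nil; rewrite big_nil Rintegral_cst// mul0r.
rewrite big_cons -IH -RintegralD//.
- by apply: eq_Rintegral => x _; rewrite big_cons.
- exact: bounded_measurable_integrable.
- by apply: bounded_measurable_integrable => //; exact: bounded_measurable_sum.
Qed.

Lemma bounded_measurable_indicM D (A : set T) g : measurable A ->
  bounded_measurable D g -> bounded_measurable D (fun x => \1_A x * g x).
Proof.
move=> mA [mg [M gM]]; split.
  by apply: measurable_funM => //; exact: measurable_indic.
exists M => x Dx; rewrite normrM; apply: le_trans (gM x Dx).
by rewrite ler_piMl// indicE; case: (x \in A); rewrite ?normr1 ?normr0.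
Qed.

Lemma Rintegral_probability_cst (P : probability T R) (r : R) :
  \int[P]_(x in setT) r = r.
Proof.
rewrite Rintegral_cst//; have -> : fine (P [set: T]) = 1; last by rewrite mulr1.
by have /= -> := @probability_setT _ _ _ P.
Qed.

End BoundedMeasurable.

(** Dominated convergence is about sequences, so a failure of continuity at [z] is first turned into
    a sequence tending to [z] along which the integrals stay apart. *)
Lemma within_continuous_Rintegral (R : realType) d (T : measurableType d)
    (mu : {finite_measure set T -> \bar R}) (Z : pseudoMetricType R) (A : set Z)
    (h : Z -> T -> R) (M : R) :
  (forall z, A z -> measurable_fun setT (h z)) ->
  (forall z w, A z -> `|h z w| <= M) ->
  (forall w, {within A, continuous (h ^~ w)}) ->
  {within A, continuous (fun z => \int[mu]_w h z w)}.
Proof.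
move=> mh hM ch; apply/within_continuousP => z Az e e0; apply: contrapT => nz.
have /choice[u uP] j : exists u, [/\ A u, ball z (j.+1%:R^-1 : R) u
    & e <= `|\int[mu]_w h z w - \int[mu]_w h u w|].
  apply: contrapT => nu; apply: nz; apply/nbhs_ballP;
    exists (j.+1%:R^-1) => //= u zu Au.
  by rewrite ltNge; apply/negP => eu; apply: nu; exists u.
have uz : u @ \oo --> z.
  apply/cvg_ballP => r r0; have [N] := ltr_add_invr r0; rewrite add0r => Nr.
  exists N => // j /= Nj; have [_ + _] := uP j; apply: le_ball.
  by apply: le_trans (ltW Nr); rewrite lef_pV2 ?posrE// ler_nat ltnS.
have : (fun j => \int[mu]_w h (u j) w) @ \oo --> \int[mu]_w h z w.
  apply: (@cvg_Rintegral _ _ _ _ _ _ _ M) => //.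
  - by move=> j; apply: mh; have [] := uP j.
  - by move=> j w _; apply: hM; have [] := uP j.
  move=> w _; apply/cvgrPdist_lt => r r0.
  have /within_continuousP/(_ z Az r r0) H := ch w.
  have : \forall j \near \oo, A (u j) -> `|h z w - h (u j) w| < r by exact: uz _ H.
  by apply: filterS => j; apply; have [] := uP j.
move=> /cvgrPdist_lt/(_ e e0)[N _ /(_ N (leqnn N))] /=.
by have [_ _] := uP N; rewrite leNgt => /negP.
Qed.

Lemma bounded_measurable_comp (R : realType) d d' (T : measurableType d)
    (T' : measurableType d') (X : T' -> T) (D : set T) (g : T -> R) :
  measurable D -> (forall w, D (X w)) -> measurable_fun setT X ->
  bounded_measurable D g -> bounded_measurable setT (fun w => g (X w)).
Proof.
move=> mD DX mX [mg [M gM]]; split; last by exists M => w _; exact: gM.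
by apply: (measurable_comp mD _ mg mX) => _ [w _ <-].
Qed.


(** * Finite mixtures of laws of random elements *)

Section WeightedLaw.
Context {R : realType} {d d' : measure_display} {T : measurableType d}
  {Z : measurableType d'}.
Variables (P : probability T R) (X : nat -> {mfun T >-> Z}) (c : nat -> {nonneg R}).
Variable N : nat.

Definition weighted_law : set Z -> \bar R :=
  msum (fun i => mscale (c i) (distribution P (X i))) N.

HB.instance Definition _ := Measure.on weighted_law.

Lemma weighted_lawE (A : set Z) :
  weighted_law A = (\sum_(i < N) (c i)%:num%:E * P (X i @^-1` A))%E.
Proof. by []. Qed.

Let weighted_law_fin : fin_num_fun weighted_law.
Proof.
move=> A mA; rewrite weighted_lawE sum_fin_num; apply/allP => _ /mapP[i _ ->].
by rewrite /= fin_numM// fin_num_measure// -[X in measurable X]setTI;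
  exact: measurable_funPT.
Qed.

HB.instance Definition _ :=
  @Measure_isFinite.Build _ Z R weighted_law weighted_law_fin.

(** Sums and multiples of measures are integrated first against nonnegative functions; a bounded [g]
    is reduced to that case by adding a constant. *)
Lemma integral_weighted_law (D : set Z) g :
  measurable D -> (forall i w, D (X i w)) -> bounded_measurable D g ->
  (\int[weighted_law]_(z in D) (g z)%:E =
   (\sum_(i < N) (c i)%:num * \int[P]_w g (X i w))%:E)%E.
Proof.
move=> mD DX bg.
have XD i : X i @^-1` D = setT by apply/seteqP; split=> // w _; exact: DX.
have bgX i (h : Z -> R) : bounded_measurable D h ->
    bounded_measurable setT (fun w => h (X i w)).
  exact: bounded_measurable_comp.
have H h : bounded_measurable D h -> (forall z, D z -> 0 <= h z) ->
  (\int[weighted_law]_(z in D) (h z)%:E =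
   (\sum_(i < N) (c i)%:num * \int[P]_w h (X i w))%:E)%E.
  move=> bh h0; have mh : measurable_fun D (EFin \o h) by apply/measurable_EFinP;
    exact: bh.1.
  rewrite ge0_integral_measure_sum//.
  rewrite -sumEFin; apply: eq_bigr => i _.
  rewrite ge0_integral_mscale//.
  rewrite EFinM; congr (_ * _)%E.
  rewrite ge0_integral_pushforward//; last by move=> z; rewrite inE => Dz;
    rewrite lee_fin h0.
  by rewrite XD integral_bounded_measurable//; exact: bgX.
have [mg [M gM]] := bg.
pose M' := `|M|; have bM := bounded_measurable_cst D M'.
have bgM := bounded_measurableD bg bM.
have gM0 z : D z -> 0 <= g z + M'.
  by move=> Dz; have := gM z Dz; have := ler_norm M; rewrite ler_norml -/M'; lra.
have -> : (\int[weighted_law]_(z in D) (g z)%:E =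
    \int[weighted_law]_(z in D) (g z + M')%:E - \int[weighted_law]_(z in D) M'%:E)%E.
  rewrite -integralB_EFin//; try exact: bounded_measurable_integrable.
  by apply: eq_integral => z _ /=; rewrite -EFinB addrK.
rewrite (H _ bgM gM0) (H (fun=> M') bM (fun _ _ => normr_ge0 M)) -EFinB -sumrB.
congr (EFin _); apply: eq_bigr => i _; rewrite -mulrBr; congr (_ * _).
rewrite -RintegralB//;
  [|exact: (bounded_measurable_integrable _ measurableT (bgX i _ bgM))|
  exact: (bounded_measurable_integrable _ measurableT (bgX i _ bM))].
by apply: eq_Rintegral => w _; rewrite addrK.
Qed.

Hypothesis c_sum1 : \sum_(i < N) (c i)%:num = 1.

(** The normalisation proof is an argument of this alias, so a probability structure can be attached
    to it while [weighted_law] remains a general finite measure, as [xi] requires. *)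
Definition weighted_probability of \sum_(i < N) (c i)%:num = 1 : set Z -> \bar R :=
  weighted_law.

HB.instance Definition _ := Measure.on (weighted_probability c_sum1).

Let weighted_probability_setT : weighted_probability c_sum1 setT = 1%E.
Proof.
rewrite /weighted_probability weighted_lawE.
under eq_bigr do rewrite preimage_setT (@probability_setT _ _ _ P) mule1.
by rewrite sumEFin c_sum1.
Qed.

HB.instance Definition _ := Measure_isProbability.Build _ Z R
  (weighted_probability c_sum1) weighted_probability_setT.

End WeightedLaw.

(** * Independence *)

Section IndependentEvent.
Context {R : realType} {d d' : measure_display} {T : measurableType d}
  {S : measurableType d'}.
Variables (P : probability T R) (F : set T) (X X0 : T -> S).
Hypotheses (mF : measurable F) (mX : measurable_fun setT X).
Hypothesis mX0 : measurable_fun setT X0.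
Hypothesis indep : forall B, measurable B ->
  P (F `&` X @^-1` B) = (P F * P (X0 @^-1` B))%E.

(** [indep] says that [P] restricted to [F] and pushed forward by [X] equals [P F] times the law of
    [X0]; it combines independence from [F] with equality in law. *)
Let nonneg_case (g : S -> R) : bounded_measurable setT g -> (forall x, 0 <= g x) ->
  \int[P]_w (\1_F w * g (X w)) = fine (P F) * \int[P]_w g (X0 w).
Proof.
move=> bg g0; have mg : measurable_fun setT (EFin \o g) by apply/measurable_EFinP;
  exact: bg.1.
have mgX : measurable_fun setT (EFin \o g \o X) by exact: measurableT_comp.
rewrite /Rintegral.
have -> : (\int[P]_w (\1_F w * g (X w))%:E = \int[P]_(w in F) (g (X w))%:E)%E.
  rewrite [RHS]integral_mkcond; apply: eq_integral => w _.
  by rewrite patchE indicE; case: ifP => _; rewrite ?mul1r ?mul0r.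
pose PF := mrestr P mF.
have -> : (\int[P]_(w in F) (g (X w))%:E = \int[PF]_(w in F) (g (X w))%:E)%E.
  by apply: eq_measure_integral => A mA AF; rewrite /PF /= /mrestr setIidl.
have -> : (\int[PF]_(w in F) (g (X w))%:E = \int[PF]_w (g (X w))%:E)%E.
  rewrite [RHS](@ge0_negligible_integral _ _ _ _ setT (~` F))//.
  - by rewrite setTD setCK.
  - exact: measurableC.
  - by move=> w _; rewrite lee_fin.
  - by rewrite /PF /= /mrestr setICl measure0.
have PF0 : 0 <= fine (P F) by rewrite fine_ge0.
have g0' : {in setT, forall x, 0%E <= (EFin \o g) x}%E by move=> x _;
  rewrite /= lee_fin.
have -> : (\int[PF]_w (g (X w))%:E = (fine (P F))%:E * \int[P]_w (g (X0 w))%:E)%E.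
  have /= <- := ge0_integral_pushforward mX PF measurableT mg g0'.
  have /= <- := ge0_integral_pushforward mX0 P measurableT mg g0'.
  rewrite -[(fine _)%:E]/((NngNum PF0)%:num%:E) -ge0_integral_mscale//; last first.
    by move=> x _; rewrite lee_fin.
  apply: eq_measure_integral => B mB _.
  transitivity ((fine (P F))%:E * P (X0 @^-1` B))%E; last by [].
  by rewrite fineK ?fin_num_measure// -indep// /pushforward /PF /= /mrestr setIC.
rewrite fineM//.
apply: integrable_fin_num => //;
  apply: (@bounded_measurable_integrable _ _ _ P setT (g \o X0)) => //.
by split; [exact: measurableT_comp bg.1 mX0|have [_ [M gM]] := bg; exists M => w _;
  exact: gM].
Qed.

Lemma integral_indep_indic (g : S -> R) : bounded_measurable setT g ->
  \int[P]_w (\1_F w * g (X w)) = fine (P F) * \int[P]_w g (X0 w).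
Proof.
move=> bg; have [mg [M gM]] := bg.
have bc (X' : T -> S) (h : S -> R) : measurable_fun setT X' ->
  bounded_measurable setT h ->
    bounded_measurable setT (fun w => h (X' w)).
  by move=> mX' bh; exact: (bounded_measurable_comp measurableT).
have b1 (X' : T -> S) (h : S -> R) : measurable_fun setT X' ->
  bounded_measurable setT h ->
    bounded_measurable setT (fun w => \1_F w * h (X' w)).
  by move=> mX' bh; apply: bounded_measurable_indicM => //; exact: bc.
have bM := bounded_measurable_cst (setT : set S) `|M|.
have bgM := bounded_measurableD bg bM.
have gM0 x : 0 <= g x + `|M|.
  by have := gM x I; have := ler_norm M; rewrite ler_norml; lra.
have integ := fun h => @bounded_measurable_integrable _ _ _ P setT h measurableT.
have H1 := nonneg_case bgM gM0.
have H2 := nonneg_case bM (fun=> normr_ge0 _).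
transitivity (\int[P]_w (\1_F w * (g (X w) + `|M|)) - \int[P]_w (\1_F w * `|M|)).
  rewrite -RintegralB//; [|exact: integ (b1 X _ mX bgM)|exact: integ (b1 X _ mX bM)].
  by apply: eq_Rintegral => w _; rewrite mulrDr addrK.
rewrite H1 H2 -mulrBr -RintegralB//.
- by congr (_ * _); apply: eq_Rintegral => w _; rewrite addrK.
- exact: integ (bc X0 _ mX0 bgM).
- exact: integ (bc X0 _ mX0 bM).
Qed.

End IndependentEvent.

(** * Functions continuous in one variable and measurable in the other *)

Section Discretization.
Context {R : realType} {n : nat} {Uhat : pointedMetricType R} {S : ptopologicalType}.
Local Notation Z := ('rV[R]_n * Uhat)%type.
Variables (G : set Z).
Hypothesis cG : compact G.

(** [r j] sends [z] to the first centre of a finite net of [G] whose ball contains it. Composing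
    with it turns a function of two variables into a finite sum of products of functions of one
    variable. *)
Lemma borel_discretization : exists (r : nat -> Z -> Z) (a : nat -> seq Z),
  [/\ forall j, uniq (a j), forall j b, b \in a j -> G b,
      forall j z, G z -> r j z \in a j,
      forall j b, @measurable _ (borelYU n Uhat) [set z | r j z = b]
    & forall z, G z -> r ^~ z @ \oo --> z].
Proof.
pose e j : R := j.+1%:R^-1; have e0 j : 0 < e j by rewrite invr_gt0.
have /choice[a aP] j := compact_net cG (e0 j).
pose rr j := foldr (fun (b : Z) (g : Z -> Z) z =>
  if `[< (ball b (e j))° z >] then b else g z) (fun=> point).
have rrP j s z : (exists2 b, b \in s & (ball b (e j))° z) ->
    rr j s z \in s /\ ball (rr j s z) (e j) z.
  elim: s => [|b s IH] [c]; first by [].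
  rewrite inE => cbs cz /=; case: ifPn => [/asboolP bz|/asboolP bz].
    by rewrite mem_head; split=> //; exact: interior_subset.
  have [|rs rz] := IH; last by split=> //; apply/orP; right.
  by move: cbs cz => /predU1P[->|cs] cz; [by []|exists c].
(* Without repetitions, exactly one indicator in a sum over the net is nonzero at a given point of
   [G]. *)
pose r j := rr j (a j); exists r, (fun j => undup (a j)); split.
- by move=> j; exact: undup_uniq.
- by move=> j b; rewrite mem_undup; exact: (aP j).1.
- by move=> j z Gz; rewrite mem_undup; have [] := rrP j (a j) z ((aP j).2 z Gz).
- move=> j b; rewrite /r; elim: (a j) => [|c s IH] /=.
    have [->|pb] := pselect (point = b).
      by rewrite [X in measurable X](_ : _ = setT)//; apply/seteqP; split.
    by rewrite [X in measurable X](_ : _ = set0)//; apply/seteqP; split.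
  have mB : @measurable _ (borelYU n Uhat) (ball c (e j))°.
    by apply: sub_sigma_algebra; exact: open_interior.
  rewrite [X in measurable X](_ : _ = ((ball c (e j))° `&` [set _ | c = b]) `|`
      (~` (ball c (e j))° `&` [set z | rr j s z = b])); last first.
    apply/seteqP; split=> z /=; case: ifPn => [/asboolP cz|/asboolP cz].
    - by left.
    - by right.
    - by move=> [[]|[]].
    - by move=> [[]|[]].
  apply: measurableU; last by apply: measurableI => //; exact: measurableC.
  apply: measurableI => //; have [->|cb] := pselect (c = b).
    by rewrite [X in measurable X](_ : _ = setT)//; apply/seteqP; split.
  by rewrite [X in measurable X](_ : _ = set0)//; apply/seteqP; split.
- move=> z Gz; apply/cvg_ballP => d d0.
  have [N] := ltr_add_invr d0; rewrite add0r => Nd; exists N => // j /= Nj.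
  apply: ball_sym; have [_ +] := rrP j (a j) z ((aP j).2 z Gz).
  apply: le_ball; apply: le_trans (ltW Nd).
  by rewrite lef_pV2 ?posrE// ler_nat ltnS.
Qed.

Variable h : Z -> S -> R.
Hypothesis ch : forall x, {within G, continuous (h ^~ x)}.
Hypothesis mh : forall z, G z -> @measurable_fun _ _ (borelType S) R setT (h z).

Let within_cvg_seq (g : Z -> R) (u : nat -> Z) z : {within G, continuous g} ->
  G z -> (forall j, G (u j)) -> u @ \oo --> z -> g \o u @ \oo --> g z.
Proof.
move=> /within_continuousP cg Gz Gu uz; apply/cvgrPdist_lt => e e0.
have : \forall j \near \oo, G (u j) ->
  `|g z - g (u j)| < e by exact: uz _ (cg z Gz e e0).
by apply: filterS => j /(_ (Gu j)).
Qed.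

(** The value 0 for centres off [G] keeps each term measurable, as [mh] covers only points of
    [G]. *)
Let simple (r : Z -> Z) (a : seq Z) z x :=
  \sum_(b <- a) \1_[set z | r z = b] z * (if `[< G b >] then h b x else 0).

Let simpleE (r : Z -> Z) (a : seq Z) (H : Z -> R) z : uniq a -> (forall b, b \in a ->
  G b) ->
  r z \in a ->
  \sum_(b <- a) \1_[set z | r z = b] z * (if `[< G b >] then H b else 0) = H (r z).
Proof.
move=> ua aG rza; rewrite (bigD1_seq (r z))//= indicE mem_set// mul1r.
rewrite asboolT ?big1 ?addr0//; last exact: aG.
move=> b brz; rewrite indicE memNset ?mul0r// => /= rzb.
by move: brz; rewrite rzb eqxx.
Qed.

Let mhG d (Om : measurableType d) (sig : Om -> borelType S) b :
  measurable_fun setT sig ->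
  measurable_fun setT (fun w => if `[< G b >] then h b (sig w) else 0).
Proof.
move=> ms; have [Gb|nGb] := pselect (G b).
  by rewrite asboolT//; exact: (measurableT_comp (mh Gb) ms).
by rewrite asboolF//; exact: measurable_cst.
Qed.

Let simple_cvg r a z x :
  [/\ forall j, uniq (a j), forall j b, b \in a j -> G b,
      forall j z, G z -> r j z \in a j,
      forall j b, @measurable _ (borelYU n Uhat) [set z | r j z = b]
    & forall z, G z -> r ^~ z @ \oo --> z] -> G z ->
  (fun j => simple (r j) (a j) z x) @ \oo --> h z x.
Proof.
move=> [ua aG ra mr rc] Gz.
rewrite (_ : (fun j => _) = (h ^~ x) \o (r ^~ z)); last first.
  by apply/funext => j; apply: (simpleE (h ^~ x)) => //; [exact: aG|exact: ra].
by apply: within_cvg_seq => // [j|]; [apply: aG; exact: ra|exact: rc].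
Qed.

Lemma measurable_fun_section_continuous d (Om : measurableType d)
    (X : Om -> borelYU n Uhat) (sig : Om -> borelType S) :
  measurable_fun setT X -> (forall w, G (X w)) -> measurable_fun setT sig ->
  measurable_fun setT (fun w => h (X w) (sig w)).
Proof.
move=> mX GX ms; have [r [a ra]] := borel_discretization.
apply: (@measurable_fun_cvg _ _ _ _ (fun j w => simple (r j) (a j) (X w) (sig w))).
  move=> j; apply: measurable_sum => b; apply: measurable_funM; last exact: mhG.
  apply: measurableT_comp => //; apply: measurable_indic.
  by have [_ _ _ + _] := ra; exact.
by move=> w _; exact: simple_cvg.
Qed.


(** A freezing lemma: the noise may be integrated with [X] held fixed. For finitely many values of
    [X] this is independence of events; bounded convergence, in the inner and in the outer integral,
    gives the rest. *)
Lemma integral_section_continuous d (Om : measurableType d) (P : probability Om R)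
    (X : Om -> borelYU n Uhat) (sig sig0 : Om -> borelType S) (M : R) :
  measurable_fun setT X -> (forall w, G (X w)) ->
  measurable_fun setT sig -> measurable_fun setT sig0 ->
  (forall A B, measurable A -> measurable B ->
    P (X @^-1` A `&` sig @^-1` B) = (P (X @^-1` A) * P (sig0 @^-1` B))%E) ->
  (forall z x, G z -> `|h z x| <= M) ->
  \int[P]_w h (X w) (sig w) = \int[P]_w (\int[P]_w' h (X w) (sig0 w')).
Proof.
move=> mX GX ms ms0 indep hM; have [r [a ra]] := borel_discretization.
have [ua aG rza mr rc] := ra.
pose hb b x := if `[< G b >] then h b x else 0.
have bhb b : @bounded_measurable R _ (borelType S) setT (hb b).
  split; first exact: (@mhG _ (borelType S) id).
  exists (Num.max M 0) => x _; rewrite /hb; case: asboolP => Gb.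
    by rewrite le_max hM.
  by rewrite normr0 le_max lexx orbT.
have hbb b (sg : Om -> borelType S) : measurable_fun setT sg ->
    bounded_measurable setT (fun w => hb b (sg w)).
  by move=> msg; exact: (bounded_measurable_comp measurableT _ msg (bhb b)).
pose hbar b := \int[P]_w hb b (sig0 w).
pose F j b := X @^-1` [set z | r j z = b].
have mF j b : measurable (F j b).
  by rewrite -[X in measurable X]setTI; apply: mX => //; exact: mr.
have M0 : 0 <= M by have := hM _ (sig point) (GX point); exact: le_trans.
have intF j b g : @bounded_measurable R _ (borelType S) setT g ->
    \int[P]_w (\1_(F j b) w * g (sig w)) = fine (P (F j b)) * \int[P]_w g (sig0 w).
  by move=> bg; apply: integral_indep_indic => // B mB; exact: indep.
have simE j z x : G z -> simple (r j) (a j) z x = h (r j z) x.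
  by move=> Gz; apply: (simpleE (h ^~ x)) => //; [exact: aG|exact: rza].
have barE j w : \sum_(b <- a j) \1_(F j b) w * hbar b =
    \int[P]_w' h (r j (X w)) (sig0 w').
  transitivity (\int[P]_w' (\sum_(b <- a j) \1_(F j b) w * hb b (sig0 w'))).
    rewrite Rintegral_bounded_sum//; last first.
      by move=> b; apply: bounded_measurableZ; exact: hbb.
    apply: eq_bigr => b _; rewrite RintegralZl//.
    exact: (bounded_measurable_integrable _ measurableT (hbb b _ ms0)).
  by apply: eq_Rintegral => w' _; exact: simE.
have L : (fun j => \int[P]_w simple (r j) (a j) (X w) (sig w)) @ \oo -->
    \int[P]_w h (X w) (sig w).
  apply: (@cvg_Rintegral _ _ _ _ _ _ _ M) => //.
  - move=> j; apply: measurable_sum => b; apply: measurable_funM; last exact: mhG.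
    by apply: measurable_indic; exact: mF.
  - by move=> j w _; rewrite simE// hM//; apply: aG (rza _ _ _).
  - by move=> w _; exact: simple_cvg.
suff : (fun j => \int[P]_w simple (r j) (a j) (X w) (sig w)) @ \oo -->
    \int[P]_w (\int[P]_w' h (X w) (sig0 w')).
  by move=> L'; exact: (cvg_unique _ L L').
have -> : (fun j => \int[P]_w simple (r j) (a j) (X w) (sig w)) =
    (fun j => \int[P]_w (\int[P]_w' h (r j (X w)) (sig0 w'))).
  apply/funext => j.
  transitivity (\sum_(b <- a j) fine (P (F j b)) * hbar b).
    rewrite Rintegral_bounded_sum//; last first.
      move=> b;
        apply: (@bounded_measurable_indicM _ _ _ setT (F j b) (fun w => hb b (sig w))) => //.
      exact: hbb.
    by apply: eq_bigr => b _; exact: intF.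
  under [RHS]eq_Rintegral do rewrite -barE.
  rewrite Rintegral_bounded_sum//; last first.
    by move=> b; apply: bounded_measurable_indicM => //; exact: bounded_measurable_cst.
  apply: eq_bigr => b _.
  have := intF j b (fun=> hbar b) (bounded_measurable_cst _ _) => ->.
  by rewrite Rintegral_probability_cst.
have hX z : G z -> bounded_measurable setT (fun w => h z (sig0 w)).
  by move=> Gz; split; [exact: (measurableT_comp (mh Gz) ms0)|exists M => w _;
    exact: hM].
apply: (@cvg_Rintegral _ _ _ _ _ _ _ M) => //.
- move=> j; under eq_fun do rewrite -barE.
  apply: measurable_sum => b; apply: measurable_funM; last exact: measurable_cst.
  by apply: measurable_indic; exact: mF.
- move=> j w _; have GrX : G (r j (X w)) by apply: aG (rza _ _ _).
  apply: le_trans (le_normr_Rintegral _ _) _ => //.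
    by apply: bounded_measurable_integrable => //; exact: hX.
  apply: (@le_trans _ _ (\int[P]_w' M)); last first.
    by rewrite Rintegral_probability_cst.
  apply: le_Rintegral => //.
  - apply: (@bounded_measurable_integrable _ _ _ P setT (fun w' => `|h (r j (X w)) (sig0 w')|)) => //.
    split; first by apply: measurableT_comp => //; exact: (hX _ GrX).1.
    by exists M => w' _; rewrite normr_id hM.
  - exact: (bounded_measurable_integrable _ measurableT (bounded_measurable_cst _ M)).
  - by move=> w' _; exact: hM.
- move=> w _; apply: (@cvg_Rintegral _ _ _ _ _ _ _ M) => //.
  - by move=> j; apply: (hX _ _).1; apply: aG (rza _ _ _).
  - by move=> j w' _; apply: hM; apply: aG (rza _ _ _).
  - move=> w' _; have := @simple_cvg r a (X w) (sig0 w') ra (GX w).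
    by under eq_fun do rewrite (simE _ _ _ (GX w)).
Qed.

End Discretization.

(** * Averages of eventually periodic sequences *)

Lemma sum_shift_indic (R : pzRingType) (x : nat -> R) (m p : nat) :
  \sum_(i < m + p) (m <= i)%N%:R * x i = \sum_(i < p) x (m + i)%N.
Proof.
rewrite big_split_ord /= big1 ?add0r => [|i _]; last by rewrite leqNgt ltn_ord mul0r.
by apply: eq_bigr => i _; rewrite leq_addr mul1r.
Qed.

Lemma sum_prefix_indic (R : pzRingType) (x : nat -> R) (m n : nat) : (m <= n)%N ->
  \sum_(i < n) (i < m)%N%:R * x i = \sum_(i < m) x i.
Proof.
move=> mn; rewrite -(subnKC mn) big_split_ord /= addrC big1 ?add0r => [|i _].
  by apply: eq_bigr => i _; rewrite ltn_ord mul1r.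
by rewrite ltnNge leq_addr mul0r.
Qed.

(** Subtracting the mean growth from the partial sums leaves a sequence [b] that is eventually
    periodic, hence bounded by [B], so the averages differ from [A] by at most [B / T]. *)
Lemma cesaro_periodic (R : realType) (a : nat -> R) (m p : nat) : (0 < p)%N ->
  (forall t, (m <= t)%N -> a t = a (t + p)%N) ->
  (fun T : nat => T%:R^-1 * \sum_(0 <= t < T) a t) @ \oo -->
  p%:R^-1 * \sum_(i < p) a (m + i)%N.
Proof.
move=> p0 ap; set A := p%:R^-1 * _; pose b T := \sum_(0 <= t < T) a t - T%:R * A.
have pA : p%:R * A = \sum_(i < p) a (m + i)%N.
  by rewrite /A mulrA mulfV ?mul1r// pnatr_eq0 -lt0n.
have window t : (m <= t)%N -> \sum_(t <= i < t + p) a i = p%:R * A.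
  move=> mt; rewrite -(subnKC mt); elim: (t - m)%N => [|j IH].
    rewrite addn0 pA -{1}[m]add0n big_addn addKn big_mkord.
    by apply: eq_bigr => i _; rewrite addnC.
  move: IH; rewrite addnS big_ltn; last by lia.
  rewrite addSn big_nat_recr/=; last by lia.
  by rewrite -ap ?leq_addr// addrC.
have bp t : (m <= t)%N -> b (t + p)%N = b t.
  move=> mt; rewrite /b (big_cat_nat (n := t))//= ?leq_addr// window//.
  by rewrite natrD mulrDl; ring.
pose B := \sum_(i < m + p) `|b i|.
have bB t : `|b t| <= B.
  elim/ltn_ind: t => t IH; have [tmp|] := ltnP t (m + p).
    by rewrite /B (bigD1 (Ordinal tmp))//= lerDl sumr_ge0.
  move=> mpt; have pt : (p <= t)%N := leq_trans (leq_addl _ _) mpt.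
  rewrite -(subnK pt) bp; last by lia.
  by apply: IH; lia.
rewrite -cvg_shiftS /=; have B0 : 0 <= B by exact: sumr_ge0.
have L : (fun t : nat => A + B * harmonic t) @ \oo --> A + B * 0.
  by apply: cvgD; [exact: cvg_cst|apply: cvgMr; exact: cvg_harmonic].
have L' : (fun t : nat => A - B * harmonic t) @ \oo --> A - B * 0.
  by apply: cvgB; [exact: cvg_cst|apply: cvgMr; exact: cvg_harmonic].
rewrite mulr0 ?subr0 ?addr0 in L L'; apply: squeeze_cvgr L' L.
apply: nearW => t /=; have -> : \sum_(0 <= i < t.+1) a i = b t.+1 + t.+1%:R * A.
  by rewrite /b subrK.
rewrite mulrDr mulrA mulVf ?pnatr_eq0// mul1r.
have h0 : 0 <= (harmonic t : R) by exact: harmonic_ge0.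
rewrite -[t.+1%:R^-1]/(harmonic t); have := ler_wpM2l h0 (bB t.+1).
rewrite -{1}(ger0_norm h0) -normrM ler_norml.
move: (harmonic t : R) (b t.+1) => h c /andP[? ?].
by apply/andP; split; lra.
Qed.

(** * The controlled process *)

(** The indicator of an open set is lower semicontinuous, hence an increasing limit of continuous
    functions; the open set is the union of the sets where these are positive. *)
Lemma measurable_fun_continuous_comp (R : realType) (n : nat) d (T : measurableType d)
    (X : T -> 'rV[R]_n) :
  (forall phi : 'rV[R]_n -> R, continuous phi -> measurable_fun setT (phi \o X)) ->
  @measurable_fun _ _ T (borelType 'rV[R]_n) setT X.
Proof.
move=> mphi.
apply: (@measurability _ _ T (borelType 'rV[R]_n) setT X open erefl) => _ [W oW <-].
pose g : 'rV[R]_n -> R := \1_(W : set 'rV[R]_n).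
have lW : lsc_on [set: 'rV[R]_n] g.
  move=> x _ a; rewrite /g indicE; case: (boolP (x \in W)) => /= [/set_mem Wx a1|_ a0].
    have nW : nbhs x (W : set 'rV[R]_n) by exact: open_nbhs_nbhs.
    apply: (@filterS _ (nbhs x) (nbhs_filter x) _ _ _ nW) => y Wy _.
    by rewrite /g indicE mem_set.
  apply: (@nearW _ (nbhs x) _ (nbhs_filter x)) => y _.
  by rewrite /g indicE; case: (y \in W) => //=; exact: lt_trans a0 _.
have [|||V [cV _ VW Vcvg]] := @lsc_monotone_approx R _ [set: 'rV[R]_n] g 1.
- by exists 0.
- by move=> x _; rewrite /g indicE; case: (x \in W); rewrite ?normr1 ?normr0.
- exact: lW.
have -> : setT `&` X @^-1` W = \bigcup_m (setT `&` (V m \o X) @^-1` `]0, +oo[).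
  apply/seteqP; split=> [w [_ /= Ww]|w [m _ [_ /=]]].
    have := Vcvg (X w) I; rewrite /g indicE mem_set// => /cvgrPdist_lt/(_ 1 ltr01)[m _].
    move=> /(_ m (leqnn m))/= H; exists m => //; split=> //=.
    by rewrite in_itv/= andbT; have := ler_norm (1 - V m (X w)); lra.
  rewrite in_itv/= andbT => V0; split=> //=; have /andP[_] := VW m (X w) I.
  rewrite /g indicE; case: (boolP (X w \in W)) => [/set_mem//|_ /=].
  by move=> /(lt_le_trans V0); rewrite ltxx.
apply: bigcupT_measurable => m; exact: mphi.
Qed.

Section Model.
Context (R : realType) (n : nat) (Uhat : pointedMetricType R)
  (S : ptopologicalType) (d : measure_display) (Om : measurableType d)
  (P : probability Om R) (s : nat -> {RV P >-> borelType S})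
  (Y : set 'rV[R]_n) (U : 'rV[R]_n -> set Uhat)
  (f : 'rV[R]_n * Uhat -> S -> 'rV[R]_n) (k : 'rV[R]_n * Uhat -> R).
Hypotheses (Y_neq0 : Y !=set0) (Y_compact : compact Y)
  (Uhat_compact : compact [set: Uhat])
  (s_indep : mutually_independent P (fun t => s t : Om -> borelType S))
  (s_ident : identically_distributed P (fun t => s t : Om -> borelType S))
  (f_continuous : forall x,
     {within Y `*` [set: Uhat], continuous (fun z => f z x)})
  (f_measurable : forall z, Y z.1 ->
     @measurable_fun _ _ (borelType S) (borelType 'rV[R]_n) setT (f z))
  (U_neq0 : forall y, Y y -> U y !=set0)
  (U_compact : forall y, Y y -> compact (U y))
  (U_usc : usc_on Y U)
  (f_invariant : forall y u x, Y y -> U y u -> Y (f (y, u) x))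
  (k_continuous : {within Y `*` [set: Uhat], continuous k}).

Local Notation Z := ('rV[R]_n * Uhat)%type.
Local Notation G := (graphG Y U).
Local Notation borelY := (borelType 'rV[R]_n).

Let Y_closed : closed Y.
Proof. exact: compact_closed (@norm_hausdorff _ _) Y_compact. Qed.

Let graph_subset : G `<=` Y `*` setT.
Proof. by move=> [y u] []. Qed.

(** If [u] is not in [U y], it has positive distance to this compact set, and upper semicontinuity
    keeps [U y'] farther than half that distance from [u] for [y'] near [y]. *)
Lemma graphG_compact : compact G.
Proof.
apply: (subclosed_compact _ (compact_setX Y_compact Uhat_compact) graph_subset).
move=> [y u] clyu; have Yy : Y y.
  apply: Y_closed => A Ay; have [|[y' u'] [[/= Yy' _] [/= Ay' _]]] := clyu (A `*` setT).
    by exists (A, setT) => //=; split=> //; exact: filterT.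
  by exists y'.
split=> //=; apply: contrapT => nUu.
have [m Um mP] : exists2 m, U y m & forall u', U y u' -> mdist u m <= mdist u u'.
  apply: lsc_on_min => //; [exact: U_compact|exact: U_neq0|].
  by apply: continuous_lsc; apply: continuous_subspaceT; exact: continuous_mdist.
have m0 : 0 < mdist u m.
  by rewrite mdist_gt0; apply/eqP => um; apply: nUu; rewrite um.
have oV : open [set x | mdist u m / 2 < mdist u x].
  by apply: (@open_comp _ _ (mdist u) [set t | mdist u m / 2 < t]);
    [move=> x _; exact: continuous_mdist|exact: open_gt].
have UV : U y `<=` [set x | mdist u m / 2 < mdist u x].
  by move=> x /mP /=; lra.
have m20 : 0 < mdist u m / 2 by rewrite divr_gt0.
pose A := [set y' | Y y' -> U y' `<=` [set x | mdist u m / 2 < mdist u x]].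
have nA : nbhs (y, u) (A `*` ball u (mdist u m / 2)).
  by exists (A, ball u (mdist u m / 2)) => //; split;
    [exact: U_usc Yy _ oV UV|exact: nbhsx_ballx].
have [[y' u'] [[/= Yy' Uu'] [/= /(_ Yy') H]]] := clyu _ nA.
by rewrite ballEmdist /= => ?; have /= := H _ Uu'; lra.
Qed.

Let G_closed : closed G.
Proof.
apply: compact_closed; last exact: graphG_compact.
by apply: hausdorff_prod; [exact: norm_hausdorff|exact: metric_hausdorff].
Qed.

Let G_borel : @measurable _ (borelYU n Uhat) G.
Proof. exact: closed_borel. Qed.
Let f_graph z x : G z -> Y (f z x).
Proof. by case: z => y u [/= Yy Uu]; exact: f_invariant. Qed.

Let within_graph (g : Z -> R) :
  {within Y `*` setT, continuous g} -> {within G, continuous g}.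
Proof. exact: continuous_subspaceW. Qed.

Lemma within_continuous_fst (phi : 'rV[R]_n -> R) :
  {within Y, continuous phi} ->
    {within Y `*` [set: Uhat], continuous (fun z => phi z.1)}.
Proof.
move=> /within_continuousP cphi; apply/within_continuousP => -[y u] [/= Yy _] e e0.
exists ([set y' | Y y' -> `|phi y - phi y'| < e], setT).
  by split=> /=; [exact: cphi|exact: filterT].
by move=> [y' u'] [/= H _] [/= /H].
Qed.

Lemma within_continuous_transition (phi : 'rV[R]_n -> R) x :
  {within Y, continuous phi} -> {within G, continuous (fun z => phi (f z x))}.
Proof.
move=> /within_continuousP cphi; apply/within_continuousP => z Gz e e0.
have H := cphi _ (f_graph x Gz) e e0.
have /subspace_continuousP/(_ z (graph_subset Gz) _ H) := @f_continuous x.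
rewrite /within /= => H'.
apply: (@filterS _ (nbhs z) (nbhs_filter z) _ _ _ H') => z' /= H'' Gz'.
by apply: H'' (f_graph x Gz'); exact: graph_subset.
Qed.

Lemma bounded_measurable_within_continuous (phi : 'rV[R]_n -> R) :
  {within Y, continuous phi} -> @bounded_measurable R _ borelY Y phi.
Proof.
move=> cphi; split; first by apply: lsc_borel_measurable => //; exact: continuous_lsc.
exact: within_continuous_bounded cphi.
Qed.

Lemma bounded_measurable_transition (phi : 'rV[R]_n -> R) z :
  @bounded_measurable R _ borelY Y phi -> G z ->
  @bounded_measurable R _ (borelType S) setT (fun x => phi (f z x)).
Proof.
move=> bphi Gz; apply: (bounded_measurable_comp _ _ _ bphi).
- exact: closed_borel.
- by move=> x; exact: f_graph.
- by apply: f_measurable; case: Gz.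
Qed.

Let M (phi : 'rV[R]_n -> R) z := \int[P]_w phi (f z (s 0%N w)).

Lemma bounded_measurable_transition0 (phi : 'rV[R]_n -> R) z :
  @bounded_measurable R _ borelY Y phi -> G z ->
  bounded_measurable setT (fun w => phi (f z (s 0%N w))).
Proof.
move=> bphi Gz; have := bounded_measurable_transition bphi Gz.
exact: bounded_measurable_comp.
Qed.

Lemma meanfE (phi : 'rV[R]_n -> R) z :
  @bounded_measurable R _ borelY Y phi -> G z -> (meanf s f phi z = (M phi z)%:E)%E.
Proof.
move=> bphi Gz; rewrite /meanf expectation_bounded_measurable//.
exact: bounded_measurable_transition0.
Qed.

Lemma within_continuous_mean (phi : 'rV[R]_n -> R) :
  {within Y, continuous phi} -> {within G, continuous (M phi)}.
Proof.
move=> cphi; have bphi := bounded_measurable_within_continuous cphi.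
have [_ [B phiB]] := bphi.
apply: (@within_continuous_Rintegral _ _ _ _ _ _ (fun z w => phi (f z (s 0%N w))) B).
- by move=> z Gz; have [] := bounded_measurable_transition0 bphi Gz.
- by move=> z w Gz; apply: phiB; exact: f_graph.
- by move=> w; exact: within_continuous_transition.
Qed.

(** * The past of the noise and its independence of the present *)

Let cyl t : set (set Om) := [set A | exists2 B : nat -> set (borelType S),
  (forall i, measurable (B i)) & A = \bigcap_(i in `I_t) s i @^-1` B i].

Local Notation Past t := (g_sigma_algebraType (cyl t)).

Let s_preimage t B : measurable B -> measurable (s t @^-1` B).
Proof. by move=> mB; rewrite -[X in measurable X]setTI; exact: measurable_funPT. Qed.

Let cyl_measurable t : cyl t `<=` @measurable _ Om.
Proof.
move=> _ [B mB ->]; apply: bigcap_measurableType => i _; exact: s_preimage.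
Qed.

Let past_measurable t A : @measurable _ (Past t) A -> @measurable _ Om A.
Proof.
by apply: smallest_sub; [exact: sigma_algebra_measurable|exact: cyl_measurable].
Qed.

Let past_sub t A : @measurable _ (Past t) A -> @measurable _ (Past t.+1) A.
Proof.
apply: smallest_sub; first exact: smallest_sigma_algebra.
move=> _ [B mB ->]; apply: sub_sigma_algebra.
exists (fun i => if (i < t)%N then B i else setT).
  by move=> i; case: ifP.
apply/seteqP; split=> w Hw i /=.
  by move=> _; case: ifPn => // it; exact: Hw.
by move=> it; have := Hw i (ltnW it : (i < t.+1)%N); rewrite /= it.
Qed.

Let measurable_noise t : @measurable_fun _ _ (Past t.+1) (borelType S) setT (s t).
Proof.
move=> _ B mB; rewrite setTI; apply: sub_sigma_algebra.
exists (fun i => if i == t then B else setT); first by move=> i; case: ifP.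
apply/seteqP; split=> w.
  by move=> Bw i _ /=; case: eqP => // ->.
by move=> /(_ t (ltnSn t)) /=; rewrite eqxx.
Qed.

Let past_fun_sub t d' (T : measurableType d') (X : Om -> T) :
  @measurable_fun _ _ (Past t) T setT X -> @measurable_fun _ _ (Past t.+1) T setT X.
Proof.
by move=> mX _ B mB; rewrite setTI; apply: past_sub;
  rewrite -[X in measurable X]setTI; exact: mX.
Qed.

Let past_fun t d' (T : measurableType d') (X : Om -> T) :
  @measurable_fun _ _ (Past t) T setT X -> @measurable_fun _ _ Om T setT X.
Proof.
by move=> mX _ B mB; rewrite setTI; apply: past_measurable;
  rewrite -[X in measurable X]setTI; exact: mX.
Qed.

Let initial := fix J t : {fset nat} := if t is t'.+1 then (t' |` J t')%fset else fset0.

Let in_initial t i : (i \in initial t) = (i < t)%N.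
Proof.
elim: t => [|t IH]; first by rewrite /= in_fset0.
by rewrite [in RHS]ltnS [in RHS]leq_eqVlt -IH /= in_fset1U.
Qed.

Let initialE t : [set` initial t] = `I_t.
Proof. by apply/seteqP; split=> i /=; rewrite in_initial. Qed.

Let noise_indep_cyl t A B : cyl t A -> measurable B ->
  (P (A `&` s t @^-1` B) = P A * P (s t @^-1` B))%E.
Proof.
(* A single family serves both index sets: the product formulas for [initial t.+1] and [initial t]
   differ exactly by the factor of [s t]. *)
move=> [C mC ->] mB; pose C' i := if (i < t)%N then C i else B.
have mC' i : measurable (C' i) by rewrite /C'; case: ifP.
have -> : \bigcap_(i in `I_t) s i @^-1` C i = \bigcap_(i in [set` initial t]) s i @^-1` C' i.
  by rewrite initialE; apply: eq_bigcapr => i /= it; rewrite /C' it.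
have -> : \bigcap_(i in [set` initial t]) s i @^-1` C' i `&` s t @^-1` B =
    \bigcap_(i in [set` initial t.+1]) s i @^-1` C' i.
  apply/seteqP; split=> w /=.
    move=> [H Bw] i /=; rewrite in_fset1U => /predU1P[->|]; last exact: H.
    by rewrite /C' ltnn.
  move=> H; split.
    by move=> i /= it; apply: H; rewrite /= in_fset1U it orbT.
  by have := H t; rewrite /= in_fset1U eqxx /C' ltnn => /(_ isT).
rewrite (s_indep (initial t.+1) mC') (s_indep (initial t) mC') /=.
rewrite big_fsetU1 ?in_initial ?ltnn//= muleC; congr (_ * _)%E.
by rewrite /C' ltnn.
Qed.

(** As functions of [A] both sides are finite measures, equal on [cyl t], which is stable under
    intersection and generates the past. The common law allows [s 0] on the right. *)
Let noise_indep t A B : @measurable _ (Past t) A -> measurable B ->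
  (P (A `&` s t @^-1` B) = P A * P (s 0%N @^-1` B))%E.
Proof.
move=> mA mB; rewrite -(s_ident t 0%N mB).
have mtB := s_preimage t mB.
have c0 : 0 <= fine (P (s t @^-1` B)) by rewrite fine_ge0.
transitivity (mscale (NngNum c0) P A); last first.
  by rewrite /mscale /= fineK ?fin_num_measure// muleC.
apply: (g_sigma_algebra_measure_unique (cyl t) _ (fun=> setT) _ _ (mrestr P mtB)) => //.
- move=> _; exists (fun=> setT) => //; apply/seteqP; split=> // w _ i _ //.
- by rewrite bigcup_const//; exists 0%N.
- move=> _ _ [B1 mB1 ->] [B2 mB2 ->]; exists (fun i => B1 i `&` B2 i).
    by move=> i; exact: measurableI.
  by rewrite -bigcapI.
- move=> C cC; transitivity (P C * P (s t @^-1` B))%E; first exact: noise_indep_cyl.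
  transitivity ((fine (P (s t @^-1` B)))%:E * P C)%E; last by [].
  by rewrite fineK ?fin_num_measure// muleC.
- by move=> _; rewrite -ge0_fin_numE// fin_num_measure.
Qed.

(** The target carries the Borel sets of the product topology; countable bases at the points of the
    two compact spaces reduce them to open rectangles. *)
Let measurable_pair d' (T : measurableType d') (X1 : T -> 'rV[R]_n) (X2 : T -> Uhat) :
  (forall w, Y (X1 w)) ->
  @measurable_fun _ _ T borelY setT X1 ->
  @measurable_fun _ _ T (borelType Uhat) setT X2 ->
  @measurable_fun _ _ T (borelYU n Uhat) setT (fun w => (X1 w, X2 w)).
Proof.
move=> YX mX1 mX2; have [B1 [oB1 B1P]] := compact_countable_base Y_compact.
have [B2 [oB2 B2P]] := compact_countable_base Uhat_compact.
apply: (@measurable_fun_base _ _ _ setT _ (nat * nat)%type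
  (fun ij => B1 ij.1 `*` B2 ij.2)).
  move=> W w oW _ Ww; have : nbhs (X1 w, X2 w) W by exact: open_nbhs_nbhs.
  move=> [[A1 A2] /= [nA1 nA2] AW].
  have [i [B1i iA]] := B1P (A1°) (X1 w) (@open_interior _ _) (YX w) nA1.
  have [j [B2j jA]] := B2P (A2°) (X2 w) (@open_interior _ _) I nA2.
  exists (i, j); split=> // -[a b] [/= /iA/interior_subset Aa /jA/interior_subset Ab].
  exact: AW.
move=> [i j] /=;
  rewrite setTI [X in measurable X](_ : _ = X1 @^-1` B1 i `&` X2 @^-1` B2 j)//.
apply: measurableI.
  by rewrite -[X in measurable X]setTI; apply: mX1 => //; exact: sub_sigma_algebra.
by rewrite -[X in measurable X]setTI; apply: mX2 => //; exact: sub_sigma_algebra.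
Qed.

(** * Measurability of trajectories and the one-step identity *)

Section Trajectory.
Variables (pi : plan n Uhat) (y0 : 'rV[R]_n).
Hypotheses (pi_plan : plans Y U pi) (Yy0 : Y y0).

Local Notation st := (state s f pi y0).
Local Notation tr := (traj s f pi y0).

Lemma state_in t w : Y (st t w).
Proof.
elim: t => //= t IH; apply: f_invariant => //; exact: (pi_plan t).2.
Qed.

Lemma traj_graph t w : G (tr t w).
Proof. by split; [exact: state_in|apply: (pi_plan t).2; exact: state_in]. Qed.

Let traj_past t : @measurable_fun _ _ (Past t) borelY setT (st t) ->
  @measurable_fun _ _ (Past t) (borelYU n Uhat) setT (tr t).
Proof.
move=> mst; apply: measurable_pair => //; first exact: state_in.
have [mpi _] := pi_plan t.
apply: (measurable_comp _ _ mpi mst); first exact: closed_borel.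
by move=> _ [w _ <-]; exact: state_in.
Qed.

(** Adaptedness to the past is what makes [s t] independent of [traj t]; the induction tests the
    next state against continuous functions. *)
Let state_past t : @measurable_fun _ _ (Past t) borelY setT (st t).
Proof.
elim: t => [|t /traj_past mtr]; first exact: measurable_cst.
apply: measurable_fun_continuous_comp => phi cphi.
have cphiY := continuous_subspaceT (A := Y) cphi.
change (@measurable_fun _ _ (Past t.+1) R setT (fun w => phi (f (tr t w) (s t w)))).
apply: (@measurable_fun_section_continuous _ _ _ _ _ graphG_compact
  (fun z x => phi (f z x)) _ _ _ (Past t.+1) (tr t) (s t)).
- by move=> x; exact: within_continuous_transition.
- move=> z Gz; apply: (bounded_measurable_transition _ Gz).1.
  exact: bounded_measurable_within_continuous.
- exact: past_fun_sub.
- exact: traj_graph.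
- exact: measurable_noise.
Qed.

Lemma measurable_state t : @measurable_fun _ _ Om borelY setT (st t).
Proof. by apply: (@past_fun t); exact: state_past. Qed.

Lemma measurable_traj t : @measurable_fun _ _ Om (borelYU n Uhat) setT (tr t).
Proof. by apply: (@past_fun t); apply: traj_past; exact: state_past. Qed.

(* The noise [s t] is independent of the past, on which [traj t] depends. *)
Lemma integral_state_succ_continuous phi t : {within Y, continuous phi} ->
  \int[P]_w phi (st t.+1 w) = \int[P]_w M phi (tr t w).
Proof.
move=> cphi; have bphi := bounded_measurable_within_continuous cphi.
have [_ [B phiB]] := bphi.
apply: (@integral_section_continuous _ _ _ _ _ graphG_compact (fun z x => phi (f z x))
  _ _ _ _ P (tr t) (s t) (s 0%N) B).
- by move=> x; exact: within_continuous_transition.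
- by move=> z Gz; apply: (bounded_measurable_transition _ Gz).1.
- exact: measurable_traj.
- exact: traj_graph.
- exact: measurable_funPT.
- exact: measurable_funPT.
- move=> A B' mA mB'; apply: noise_indep => //.
  by rewrite -[X in measurable X]setTI; exact: (traj_past (@state_past t)).
- by move=> z x Gz; apply: phiB; exact: f_graph.
Qed.

End Trajectory.

(** * One-step means of bounded lower semicontinuous functions *)

Definition bounded_lsc (V : 'rV[R]_n -> R) :=
  lsc_on Y V /\ exists B, forall y, Y y -> `|V y| <= B.

Lemma bounded_measurable_bounded_lsc V :
  bounded_lsc V -> @bounded_measurable R _ borelY Y V.
Proof. by move=> [lV bV]; split=> //; exact: lsc_borel_measurable. Qed.

Lemma continuous_bounded_lsc V : {within Y, continuous V} -> bounded_lsc V.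
Proof. by move=> cV; split;
  [exact: continuous_lsc|exact: within_continuous_bounded]. Qed.

Lemma le_mean V W z : @bounded_measurable R _ borelY Y V ->
  @bounded_measurable R _ borelY Y W -> (forall y, Y y -> V y <= W y) ->
  G z -> M V z <= M W z.
Proof.
move=> bV bW VW Gz; apply: le_Rintegral => //.
- by apply: bounded_measurable_integrable => //; exact: bounded_measurable_transition0.
- by apply: bounded_measurable_integrable => //; exact: bounded_measurable_transition0.
- by move=> w _; apply: VW; exact: f_graph.
Qed.

Lemma mean_cst c z : M (fun=> c) z = c.
Proof. exact: Rintegral_probability_cst. Qed.

Lemma meanD V W z : @bounded_measurable R _ borelY Y V ->
  @bounded_measurable R _ borelY Y W -> G z ->
  M (fun y => V y + W y) z = M V z + M W z.
Proof.
move=> bV bW Gz; rewrite /M RintegralD//;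
by apply: bounded_measurable_integrable => //; exact: bounded_measurable_transition0.
Qed.

Lemma meanZ c V z : @bounded_measurable R _ borelY Y V -> G z ->
  M (fun y => c * V y) z = c * M V z.
Proof.
move=> bV Gz; rewrite /M RintegralZl//.
by apply: bounded_measurable_integrable => //; exact: bounded_measurable_transition0.
Qed.

Lemma mean_bounded V B z : @bounded_measurable R _ borelY Y V ->
  (forall y, Y y -> `|V y| <= B) -> G z -> `|M V z| <= B.
Proof.
move=> bV VB Gz; have bc c := @bounded_measurable_cst R _ borelY Y c.
rewrite ler_norml -{2}(mean_cst B z) -(mean_cst (- B) z).
by apply/andP; split; apply: le_mean => // y /VB; rewrite ler_norml => /andP[].
Qed.

Lemma cvg_mean (V_ : nat -> 'rV[R]_n -> R) V B z :
  (forall m, @bounded_measurable R _ borelY Y (V_ m)) ->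
  (forall m y, Y y -> `|V_ m y| <= B) ->
  (forall y, Y y -> V_ ^~ y @ \oo --> V y) -> G z ->
  (fun m => M (V_ m) z) @ \oo --> M V z.
Proof.
move=> bV VB VV Gz; apply: (@cvg_Rintegral _ _ _ _ _ _ _ B) => //.
- by move=> m; have [] := bounded_measurable_transition0 (bV m) Gz.
- by move=> m w _; apply: VB; exact: f_graph.
- by move=> w _; apply: VV; exact: f_graph.
Qed.

Lemma bounded_lsc_approx V : bounded_lsc V ->
  exists (V_ : nat -> 'rV[R]_n -> R) (B : R),
    [/\ forall m, {within Y, continuous (V_ m)},
        forall m m' y, (m <= m')%N -> Y y -> V_ m y <= V_ m' y,
        forall m y, Y y -> V_ m y <= V y,
        forall m y, Y y -> `|V_ m y| <= B
      & forall y, Y y -> V_ ^~ y @ \oo --> V y].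
Proof.
move=> [lV [B VB]]; have [V_ [cV V_S V_V V_cvg]] := lsc_monotone_approx Y_neq0 VB lV.
exists V_, B; split => //.
- by move=> m; apply: continuous_subspaceT; exact: cV.
- move=> m m' y mm' Yy; rewrite -(subnKC mm').
  elim: (m' - m)%N => [|j IH]; first by rewrite addn0.
  by rewrite addnS (le_trans IH)// V_S.
- by move=> m y /(V_V m) /andP[].
- move=> m y Yy; have /andP[? ?] := V_V m y Yy; have := VB y Yy.
  by rewrite !ler_norml => /andP[? ?]; apply/andP; split; lra.
Qed.

(** [M V] is the increasing limit of continuous functions [M (V_ m)], so a strict lower bound at a
    point is one for some [M (V_ m)], hence for [M V] nearby. *)
Lemma lsc_mean V : bounded_lsc V -> lsc_on G (M V).
Proof.
move=> lV; have [V_ [B [cV V_mono V_V VB V_cvg]]] := bounded_lsc_approx lV.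
have bV_ m := bounded_measurable_within_continuous (cV m).
move=> z Gz a aV.
have := cvg_mean bV_ VB V_cvg Gz.
move=> /cvgrPdist_lt/(_ (M V z - a));
  rewrite subr_gt0 => /(_ aV)[m _ /(_ m (leqnn m))] /= H.
have aVm : a < M (V_ m) z by have := ler_norm (M V z - M (V_ m) z); lra.
have := continuous_lsc (within_continuous_mean (cV m)) Gz aVm.
apply: (@filterS _ (nbhs z) (nbhs_filter z)) => z' H' Gz'.
apply: lt_le_trans (H' Gz') _; apply: le_mean => //.
  exact: bounded_measurable_bounded_lsc.
exact: V_V.
Qed.

Lemma measurable_mean V : bounded_lsc V ->
  @bounded_measurable R _ (borelYU n Uhat) G (M V).
Proof.
move=> lV; split; first by apply: lsc_borel_measurable => //; exact: lsc_mean.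
have [_ [B VB]] := lV; exists B => z Gz; apply: mean_bounded => //.
exact: bounded_measurable_bounded_lsc.
Qed.

Lemma integral_state_succ pi y0 V t : plans Y U pi -> Y y0 -> bounded_lsc V ->
  \int[P]_w V (state s f pi y0 t.+1 w) = \int[P]_w M V (traj s f pi y0 t w).
Proof.
move=> pi_plan Yy0 lV; have [V_ [B [cV V_mono V_V VB V_cvg]]] := bounded_lsc_approx lV.
have bV_ m := bounded_measurable_within_continuous (cV m).
have L1 : (fun m => \int[P]_w V_ m (state s f pi y0 t.+1 w)) @ \oo -->
    \int[P]_w V (state s f pi y0 t.+1 w).
  have Yst w := state_in pi_plan Yy0 t.+1 w.
  apply: (@cvg_Rintegral _ _ _ _ _ _ _ B) => //; last 2 first.
  - by move=> m w _; exact: VB.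
  - by move=> w _; exact: V_cvg.
  move=> m; apply: (bounded_measurable_comp _ _ _ (bV_ m)).1 => //.
    exact: closed_borel.
  exact: (measurable_state pi_plan Yy0 t.+1).
suff : (fun m => \int[P]_w V_ m (state s f pi y0 t.+1 w)) @ \oo -->
    \int[P]_w M V (traj s f pi y0 t w) by move=> L2; exact: (cvg_unique _ L1 L2).
under eq_fun do rewrite (integral_state_succ_continuous pi_plan Yy0 t (cV _)).
have Gtr w := traj_graph pi_plan Yy0 t w.
apply: (@cvg_Rintegral _ _ _ _ _ _ _ B) => //.
- move=> m; apply: (bounded_measurable_comp G_borel _ _ _).1 => //.
    exact: measurable_traj.
  by apply: measurable_mean; exact: continuous_bounded_lsc.
- by move=> m w _; apply: mean_bounded => //; exact: VB.
- by move=> w _; exact: (cvg_mean bV_ VB V_cvg (Gtr w)).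
Qed.


(** * Dynamic programming *)

Let k_bounded_measurable : @bounded_measurable R _ (borelYU n Uhat) G k.
Proof.
split; last exact: within_continuous_bounded graphG_compact (within_graph k_continuous).
by apply: lsc_borel_measurable => //; apply: continuous_lsc; exact: within_graph.
Qed.

Lemma bounded_measurable_traj pi y0 t (g : Z -> R) : plans Y U pi -> Y y0 ->
  @bounded_measurable R _ (borelYU n Uhat) G g ->
  bounded_measurable setT (fun w => g (traj s f pi y0 t w)).
Proof.
move=> pi_plan Yy0; apply: bounded_measurable_comp => //.
  exact: traj_graph.
exact: measurable_traj.
Qed.

Lemma bounded_measurable_state pi y0 t (g : 'rV[R]_n -> R) : plans Y U pi -> Y y0 ->
  @bounded_measurable R _ borelY Y g ->
  bounded_measurable setT (fun w => g (state s f pi y0 t w)).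
Proof.
move=> pi_plan Yy0; apply: bounded_measurable_comp => //.
- exact: closed_borel.
- exact: state_in.
- exact: measurable_state.
Qed.

(** Sublevel sets of the minimum are projections of compact subsets of [G], hence closed; the upper
    semicontinuity of [U] enters through the compactness of [G]. *)
Lemma bellman V : bounded_lsc V -> exists (W : 'rV[R]_n -> R) (sel : 'rV[R]_n -> Uhat),
  [/\ bounded_lsc W, @measurable_fun _ _ borelY (borelType Uhat) Y sel,
      forall y, Y y -> U y (sel y) /\ W y = k (y, sel y) + M V (y, sel y)
    & forall z, G z -> W z.1 <= k z + M V z].
Proof.
move=> lV; pose Q z := k z + M V z.
have lQ : lsc_on G Q.
  by apply: lsc_onD; [apply: continuous_lsc; exact: within_graph|exact: lsc_mean].
have [sel [msel selP]] := measurable_argmin (@norm_hausdorff _ _) Y_compact Uhat_compact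
  graphG_compact lQ U_neq0.
exists (fun y => Q (y, sel y)), sel; split => //.
- split.
    move=> y Yy a aW; pose D := G `&` [set z | Q z <= a].
    have cD : closed (fst @` D).
      apply: compact_closed; first exact: norm_hausdorff.
      apply: continuous_compact.
        by apply: continuous_subspaceT => z; exact: cvg_fst.
      apply: (subclosed_compact _ graphG_compact); last by move=> z [].
      exact: lsc_on_closed.
    have nD : ~ (fst @` D) y.
      move=> [[y' u] [[/= _ Uu] Qa] yy']; rewrite /= in yy'; subst y'.
      by have := (selP y Yy).2 u Uu; rewrite leNgt (le_lt_trans Qa).
    have := open_nbhs_nbhs (conj (closed_openC cD) nD).
    apply: (@filterS _ (nbhs y) (nbhs_filter y)) => y' nD' Yy'.
    rewrite ltNge; apply/negP => Qa; apply: nD'; exists (y', sel y') => //.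
    by split=> //; split=> //=; exact: (selP y' Yy').1.
  have [_ [B VB]] := lV; have [_ [K kK]] := k_bounded_measurable.
  exists (K + B) => y Yy; have Gy : G (y, sel y) by split=> //=; exact: (selP y Yy).1.
  rewrite (le_trans (ler_normD _ _))// lerD ?kK//; apply: mean_bounded => //.
  exact: bounded_measurable_bounded_lsc.
- by move=> y Yy; split=> //; exact: (selP y Yy).1.
- by move=> [y u] [/= Yy Uu]; exact: (selP y Yy).2.
Qed.

(** [V t] is the optimal total cost over [t] stages, and [sel t] is the first decision when [t.+1]
    stages remain. *)
Definition value_functions (V : nat -> 'rV[R]_n -> R) :=
  [/\ forall y, V 0%N y = 0, forall t, bounded_lsc (V t),
      exists sel : nat -> 'rV[R]_n -> Uhat, forall t,
        @measurable_fun _ _ borelY (borelType Uhat) Y (sel t) /\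
        forall y, Y y -> U y (sel t y) /\
          V t.+1 y = k (y, sel t y) + M (V t) (y, sel t y)
    & forall t z, G z -> V t.+1 z.1 <= k z + M (V t) z].

Lemma exists_value_functions : exists V, value_functions V.
Proof.
have /choice[F FP] V : exists WS : ('rV[R]_n -> R) * ('rV[R]_n -> Uhat),
    bounded_lsc V -> [/\ bounded_lsc WS.1,
      @measurable_fun _ _ borelY (borelType Uhat) Y WS.2,
      forall y, Y y -> U y (WS.2 y) /\ WS.1 y = k (y, WS.2 y) + M V (y, WS.2 y)
    & forall z, G z -> WS.1 z.1 <= k z + M V z].
  have [lV|nlV] := pselect (bounded_lsc V); last by exists (V, fun=> point) => /nlV.
  by have [W [sel H]] := bellman lV; exists (W, sel).
pose V t := iter t (fun V => (F V).1) (fun=> 0).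
have lV t : bounded_lsc (V t).
  elim: t => [|t IH]; last by have [] := FP _ IH.
  by apply: continuous_bounded_lsc; exact: cst_continuous.
exists V; split => //.
- exists (fun t => (F (V t)).2) => t.
  by have [_ msel selP _] := FP _ (lV t).
- by move=> t; have [_ _ _] := FP _ (lV t).
Qed.

Lemma costE pi y0 T : plans Y U pi -> Y y0 ->
  cost s f k pi y0 T = (\sum_(0 <= t < T) \int[P]_w k (traj s f pi y0 t w))%:E.
Proof.
move=> pi_plan Yy0; rewrite /cost expectation_bounded_measurable.
  rewrite Rintegral_bounded_sum// => t; exact: bounded_measurable_traj.
by apply: bounded_measurable_sum => t; exact: bounded_measurable_traj.
Qed.

(** The starting time [t] is left free because each Bellman step shortens the horizon and advances
    the clock. *)
Lemma value_le_cost V pi y0 : value_functions V -> plans Y U pi -> Y y0 -> forall j t,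
  \int[P]_w V j (state s f pi y0 t w) <=
  \sum_(t <= i < t + j) \int[P]_w k (traj s f pi y0 i w).
Proof.
move=> [V0 lV _ VS] pi_plan Yy0; elim=> [|j IH] t.
  rewrite addn0 big_geq//; under eq_Rintegral do rewrite V0.
  by rewrite Rintegral_probability_cst.
rewrite big_ltn ?addnS ?ltnS ?leq_addr// -addSn.
apply: le_trans (_ : \int[P]_w (k (traj s f pi y0 t w) + M (V j) (traj s f pi y0 t w)) <= _).
  apply: le_Rintegral => //.
  - apply: bounded_measurable_integrable => //; apply: bounded_measurable_state => //.
    exact: bounded_measurable_bounded_lsc.
  - apply: bounded_measurable_integrable => //; apply: bounded_measurableD;
      by apply: bounded_measurable_traj => //; exact: measurable_mean.
  - by move=> w _; have := VS j _ (traj_graph pi_plan Yy0 t w).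
rewrite RintegralD//; last 2 first.
- by apply: bounded_measurable_integrable => //; exact: bounded_measurable_traj.
- apply: bounded_measurable_integrable => //; apply: bounded_measurable_traj => //.
  exact: measurable_mean.
by rewrite lerD2l -integral_state_succ.
Qed.

Lemma exists_optimal_plan V y0 T : value_functions V -> Y y0 -> exists2 pi,
  plans Y U pi & V T y0 = \sum_(0 <= t < T) \int[P]_w k (traj s f pi y0 t w).
Proof.
(* At time [t < T] there remain [T - t] stages, whose minimiser has index one less. *)
move=> [V0 lV [sel selP] VS] Yy0; pose pi t := sel (T.-1 - t)%N.
have pi_plan : plans Y U pi.
  by move=> t; have [msel selU] := selP (T.-1 - t)%N; split=> // y /selU[].
exists pi => //.
suff H j t : (t + j = T)%N -> \int[P]_w V j (state s f pi y0 t w) =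
    \sum_(t <= i < T) \int[P]_w k (traj s f pi y0 i w).
  by have := H T 0%N (add0n T); rewrite /= Rintegral_probability_cst.
elim: j t => [|j IH] t tT.
  rewrite -tT addn0 big_geq//; under eq_Rintegral do rewrite V0.
  by rewrite Rintegral_probability_cst.
rewrite big_ltn -?tT ?addnS ?ltnS ?leq_addr// -addnS tT -IH;
  last by rewrite addSn -addnS.
rewrite integral_state_succ// -RintegralD//; last 2 first.
- by apply: bounded_measurable_integrable => //; exact: bounded_measurable_traj.
- apply: bounded_measurable_integrable => //; apply: bounded_measurable_traj => //.
  exact: measurable_mean.
apply: eq_Rintegral => w _.
have -> : j = (T.-1 - t)%N by rewrite -tT addnS /= addKn.
by have [_ /(_ _ (state_in pi_plan Yy0 t w))[_ ->]] := selP (T.-1 - t)%N.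
Qed.

Lemma vTE V T y : value_functions V -> Y y ->
  vT s Y U f k T y = (T%:R^-1 * V T y)%:E.
Proof.
move=> HV Yy; rewrite /vT EFinM; congr (_ * _)%E; apply/eqP; rewrite eq_le;
  apply/andP; split.
  have [pi pi_plan ->] := exists_optimal_plan T HV Yy.
  by apply: ge_ereal_inf; exists (cost s f k pi y T); [exists pi|rewrite costE].
apply: le_ereal_inf_tmp => _ [pi pi_plan <-]; rewrite costE// lee_fin.
have := value_le_cost HV pi_plan Yy T 0%N.
by rewrite /= Rintegral_probability_cst add0n.
Qed.


(** * Subsolutions of the dual problem *)

Variable v : 'rV[R]_n -> R.
Hypotheses (v_limit : forall y, Y y ->
     (fun T : nat => vT s Y U f k T y) @ \oo --> (v y)%:E)
  (v_continuous : {within Y, continuous v}).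

Let bv := bounded_measurable_within_continuous v_continuous.

Lemma value_bound V K t y : value_functions V -> (forall z, G z -> `|k z| <= K) ->
  Y y -> `|V t y| <= t%:R * K.
Proof.
move=> [V0 lV [sel selP] _] kK; elim: t y => [|t IH] y Yy;
  first by rewrite V0 normr0 mul0r.
have [_ /(_ y Yy)[Uy ->]] := selP t; have Gy : G (y, sel t y) by [].
rewrite (le_trans (ler_normD _ _))// -natr1 mulrDl mul1r addrC lerD ?kK//.
apply: mean_bounded => //; exact: bounded_measurable_bounded_lsc.
Qed.

(** The shifted index avoids the empty horizon. *)
Let average (V : nat -> 'rV[R]_n -> R) m y := V m.+1 y / m.+1%:R.

Lemma cvg_average V y : value_functions V -> Y y -> average V ^~ y @ \oo --> v y.
Proof.
move=> HV Yy; rewrite /average; have := v_limit Yy.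
under eq_fun do rewrite (vTE _ HV Yy).
move=> /fine_cvg; rewrite -cvg_shiftS /=.
by under eq_fun do rewrite mulrC.
Qed.

Lemma average_bound V K m y : value_functions V -> (forall z, G z -> `|k z| <= K) ->
  Y y -> `|average V m y| <= K.
Proof.
move=> HV kK Yy; rewrite /average normrM normfV (ger0_norm (ler0n _ _)).
by rewrite ler_pdivrMr// mulrC; exact: value_bound.
Qed.

(** In the Bellman inequality for [V m.+2] divided by [m.+2], the running cost vanishes and [c m],
    which is [V m.+1] over [m.+2], still tends to [v]. *)
Lemma le_mean_limit z : G z -> v z.1 <= M v z.
Proof.
move=> Gz; have [V HV] := exists_value_functions; have [V0 lV _ VS] := HV.
have [_ [K kK]] := k_bounded_measurable.
pose c m y := average V m y * (m.+1%:R / m.+2%:R).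
have c1 : (fun m : nat => (m.+1%:R / m.+2%:R : R)) @ \oo --> (1 : R).
  have : (fun m => 1 - (harmonic m.+1 : R)) @ \oo --> (1 - 0 : R).
    by apply: cvgB; [exact: cvg_cst|have := @cvg_harmonic R; rewrite -cvg_shiftS].
  rewrite subr0; under eq_fun do rewrite /harmonic /=.
  rewrite (_ : (fun m : nat => 1 - m.+2%:R^-1 : R) = (fun m : nat => m.+1%:R / m.+2%:R))//.
  apply/funext => m; have ->
    : m.+1%:R = m.+2%:R - 1 :> R by rewrite -[m.+2%:R]natr1 addrK.
  by rewrite mulrBl divff// mul1r.
have bc m : @bounded_measurable R _ borelY Y (c m).
  have -> : c m = (fun y => (m.+2%:R^-1 : R) * V m.+1 y).
    by apply/funext => y; rewrite /c /average; rewrite mulrA divfK ?pnatr_eq0// mulrC.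
  by apply: bounded_measurableZ; exact: bounded_measurable_bounded_lsc.
have cK m y : Y y -> `|c m y| <= K.
  move=> Yy; rewrite /c normrM; apply: le_trans (average_bound m HV kK Yy).
  by rewrite ler_piMr// ger0_norm ?divr_ge0// ler_pdivrMr// mul1r ler_nat.
have cv y : Y y -> c ^~ y @ \oo --> v y.
  by move=> Yy; rewrite -[v y]mulr1; apply: cvgM => //; exact: cvg_average.
have L := cvg_mean bc cK cv Gz.
have L' : (fun m => k z * m.+2%:R^-1 + M (c m) z) @ \oo --> k z * 0 + M v z.
  apply: cvgD => //; apply: cvgMr.
  by have := @cvg_harmonic R; rewrite -cvg_shiftS.
have Yz : Y z.1 by case: Gz.
have := cvg_average HV Yz; rewrite -cvg_shiftS => L0.
rewrite mulr0 add0r in L'; apply: ler_cvg_to L0 L' _; apply: nearW => m.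
have -> : M (c m) z = m.+2%:R^-1 * M (V m.+1) z.
  rewrite -meanZ//; last exact: bounded_measurable_bounded_lsc.
  by apply: eq_Rintegral => w _; rewrite /c /average;
    rewrite mulrA divfK ?pnatr_eq0// mulrC.
rewrite /average (mulrC (k z)) -mulrDr /= mulrC ler_wpM2l//; exact: VS.
Qed.

(** The slack of the first dual constraint for [psi = v] and [mu = v y0], where [v y0] cancels. *)
Let gap eta z := k z - v z.1 + M eta z - eta z.1.

Lemma exists_lsc_subsolution e : 0 < e ->
  exists2 eta, bounded_lsc eta & forall z, G z -> - e <= gap eta z.
Proof.
move=> e0; have [V HV] := exists_value_functions; have [V0 lV _ VS] := HV.
have [_ [K kK]] := k_bounded_measurable.
have [_ [B vB]] := bv.
have lN : lsc_on Y (fun y => - v y).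
  apply: continuous_lsc => y; apply: cvgN; exact: v_continuous.
(* The role of the convex hull of the functions [average V m - v], [m >= N], is played by properties
   stable under midpoints. Each member keeps a witness [eta], [gap] being affine in it, and the last
   clause passes the pointwise limit on to all members. *)
pose C N : set ('rV[R]_n -> R) := [set g | [/\ lsc_on Y g, forall y, Y y ->
  `|g y| <= K + B,
  exists2 eta, bounded_lsc eta & forall z, G z -> g z.1 <= gap eta z
  & forall y b, Y y -> (forall m, (N <= m)%N -> b <= average V m y - v y) -> b <= g y]].
have C_average m : C m (fun y => average V m y - v y).
  split.
  - apply: lsc_onD => //; rewrite /average.
    under eq_fun do rewrite mulrC; apply: lsc_onZ; first by rewrite invr_ge0.
    by have [] := lV m.+1.
  - move=> y Yy; rewrite (le_trans (ler_normB _ _))// lerD ?vB//.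
    exact: average_bound.
  - exists (fun y => (m.+1%:R^-1 : R) * \sum_(0 <= i < m.+1) V i y).
      have lS j : bounded_lsc (fun y => \sum_(0 <= i < j) V i y).
        elim: j => [|j [IHl [Bj IHb]]].
          under eq_fun do rewrite big_geq//.
          by apply: continuous_bounded_lsc; exact: cst_continuous.
        have [lj [D VD]] := lV j; under eq_fun do rewrite big_nat_recr//=.
        split; first exact: lsc_onD.
        by exists (Bj + D) => y Yy; rewrite (le_trans (ler_normD _ _))// lerD ?IHb ?VD.
      have [lm [D SD]] := lS m.+1; split; first by apply: lsc_onZ => //;
        rewrite invr_ge0.
      by exists (m.+1%:R^-1 * D) => y Yy;
        rewrite normrM ger0_norm ?invr_ge0// ler_wpM2l ?invr_ge0// SD.
    move=> z Gz; have bV i := bounded_measurable_bounded_lsc (lV i).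
    rewrite /gap meanZ//; last by apply: bounded_measurable_sum.
    have -> : M (fun y => \sum_(0 <= i < m.+1) V i y) z = \sum_(0 <= i < m.+1) M (V i) z.
      rewrite /M Rintegral_bounded_sum// => i; exact: bounded_measurable_transition0.
    have : \sum_(0 <= i < m.+1) (V i.+1 z.1 - V i z.1) <=
        \sum_(0 <= i < m.+1) (k z + M (V i) z - V i z.1).
      by apply: ler_sum_nat => i _; rewrite lerD2r; exact: VS.
    rewrite telescope_sumr// V0 subr0 !big_split /= sumrN sumr_const_nat subn0.
    have m0 : 0 <= m.+1%:R^-1 :> R by rewrite invr_ge0.
    move=> /(ler_wpM2l m0);
      rewrite -[k z *+ _]mulr_natl !mulrDr mulrA mulVf ?pnatr_eq0// mul1r mulrN.
    rewrite /average [V m.+1 z.1 / _]mulrC /=.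
    move: (_ * V _ _) (_ * \sum_(_ <= _ < _) M _ _) (_ * \sum_(_ <= _ < _) V _ _) => a1 a2 a3.
    lra.
  - by move=> y b Yy H; exact: H.
have C_decr N : C N.+1 `<=` C N.
  move=> g [lg gB geta gb]; split=> // y b Yy H; apply: gb => // m Nm; apply: H.
  exact: ltnW.
have C_nonempty N : C N !=set0 by exists (fun y => average V N y - v y).
have C_mid N g h : C N g -> C N h -> C N (fun y => (g y + h y) / 2).
  move=> [lg gB [eg leg gg] gb] [lh hB [eh leh hh] hb].
  have half0 : 0 <= (2^-1 : R) by rewrite invr_ge0.
  split.
  - under eq_fun do rewrite mulrC; apply: lsc_onZ => //; exact: lsc_onD.
  - move=> y Yy; have := gB y Yy; have := hB y Yy; rewrite !ler_norml.
    by move=> /andP[? ?] /andP[? ?]; apply/andP; split; lra.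
  - exists (fun y => 2^-1 * (eg y + eh y)).
      have [leg1 [Bg egB]] := leg; have [leh1 [Bh ehB]] := leh; split.
        by apply: lsc_onZ => //; exact: lsc_onD.
      exists (Bg + Bh) => y Yy; have := egB y Yy; have := ehB y Yy; rewrite !ler_norml.
      by move=> /andP[? ?] /andP[? ?]; apply/andP; split; lra.
    move=> z Gz; have beg := bounded_measurable_bounded_lsc leg.
    have beh := bounded_measurable_bounded_lsc leh.
    rewrite /gap meanZ//; last exact: bounded_measurableD.
    rewrite meanD//; have := gg z Gz; have := hh z Gz; rewrite /gap; lra.
  - by move=> y b Yy H; have := gb y b Yy H; have := hb y b Yy H; lra.
have C_bnd g x : C 0%N g -> Y x -> `|g x| <= K + B by move=> [_ gB _ _]; exact: gB.
have C_lsc g : C 0%N g -> lsc_on Y g by move=> [].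
have C_pt y r : Y y -> 0 < r -> exists N, forall g, C N g -> - r <= g y.
  move=> Yy r0; have /cvgrPdist_le/(_ r r0)[N _ HN] := cvg_average HV Yy.
  exists N => g [_ _ _ gb]; apply: gb => // m /HN /=.
  by rewrite ler_norml => /andP[_ ?]; lra.
have [g [_ _ [eta leta etaP] _] ge] :=
  simons Y_compact Y_neq0 C_decr C_mid C_bnd C_lsc C_nonempty C_pt e0.
exists eta => // z Gz; apply: le_trans (etaP z Gz); apply: ge.
by case: Gz.
Qed.

Lemma exists_continuous_subsolution e : 0 < e ->
  exists2 eta, {within Y, continuous eta} & forall z, G z -> - e <= gap eta z.
Proof.
move=> e0; have e20 : 0 < e / 2 by rewrite divr_gt0.
have [eta leta etaP] := exists_lsc_subsolution e20.
have beta := bounded_measurable_bounded_lsc leta.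
have [h [B [ch h_mono h_eta hB h_cvg]]] := bounded_lsc_approx leta.
have [_ [K kK]] := k_bounded_measurable; have [_ [Bv vB]] := bv.
have bh m := bounded_measurable_within_continuous (ch m).
(* [phi] is squeezed because it enters [gap] twice: the bound by [h N] keeps [M phi] large and the
   bound by [eta] keeps [- phi] large. The offset [e / 2] compensates the defect of [eta]. *)
pose C N : set (Z -> R) := [set g | exists phi, [/\ {within Y, continuous phi},
  forall y, Y y -> `|phi y| <= B, forall y, Y y -> h N y <= phi y <= eta y &
  forall z, G z -> g z = e / 2 + gap phi z]].
have Yz z : G z -> Y z.1 by case.
have gap_cont (phi : 'rV[R]_n -> R) : {within Y, continuous phi} ->
  {within G, continuous (gap phi)}.
  move=> cphi z.
  have c1 : {within G, continuous k} by exact: within_graph.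
  have c2 : {within G, continuous (fun z => v z.1)}.
    by apply: within_graph; exact: within_continuous_fst.
  have c3 : {within G, continuous (fun z => phi z.1)}.
    by apply: within_graph; exact: within_continuous_fst.
  have c4 := within_continuous_mean cphi.
  by apply: cvgB; [apply: cvgD; [apply: cvgB;
    [exact: c1|exact: c2]|exact: c4]|exact: c3].
have [B' gapB] : exists B', forall phi : 'rV[R]_n -> R, {within Y, continuous phi} ->
    (forall y, Y y -> `|phi y| <= B) -> forall z, G z -> `|gap phi z| <= B'.
  exists (K + Bv + B + B) => phi cphi phiB z Gz; rewrite /gap.
  have bphi := bounded_measurable_within_continuous cphi.
  have := kK z Gz; have := vB _ (Yz z Gz); have := phiB _ (Yz z Gz).
  have := mean_bounded bphi phiB Gz; rewrite !ler_norml.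
  move=> /andP[? ?] /andP[? ?] /andP[? ?] /andP[? ?]; apply/andP; split; lra.
have gap_mid (phi psi : 'rV[R]_n -> R) z : {within Y, continuous phi} ->
  {within Y, continuous psi} -> G z ->
    gap (fun y => 2^-1 * (phi y + psi y)) z = (gap phi z + gap psi z) / 2.
  move=> /bounded_measurable_within_continuous bphi /bounded_measurable_within_continuous bpsi Gz.
  rewrite /gap meanZ//; last exact: bounded_measurableD.
  by rewrite meanD//; lra.
have C_decr N : C N.+1 `<=` C N.
  move=> g [phi [cphi phiB hphi gE]]; exists phi; split=> // y Yy.
  have /andP[hy ->] := hphi y Yy; rewrite andbT; apply: le_trans hy.
  exact: h_mono.
have C_nonempty N : C N !=set0.
  exists (fun z => e / 2 + gap (h N) z), (h N); split=> // y Yy; first exact: hB.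
  by rewrite lexx h_eta.
have C_mid N g1 g2 : C N g1 -> C N g2 -> C N (fun z => (g1 z + g2 z) / 2).
  move=> [p1 [c1 b1 h1 g1E]] [p2 [c2 b2 h2 g2E]].
  exists (fun y => 2^-1 * (p1 y + p2 y)); split.
  - by move=> y; apply: cvgMr; apply: cvgD; [exact: c1|exact: c2].
  - move=> y Yy; have := b1 y Yy; have := b2 y Yy; rewrite !ler_norml.
    by move=> /andP[? ?] /andP[? ?]; apply/andP; split; lra.
  - move=> y Yy; have /andP[? ?] := h1 y Yy; have /andP[? ?] := h2 y Yy.
    by apply/andP; split; lra.
  - by move=> z Gz; rewrite gap_mid// g1E// g2E//; lra.
have C_bnd g z : C 0%N g -> G z -> `|g z| <= e + B'.
  move=> [phi [cphi phiB _ gE]] Gz; rewrite gE//.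
  have := gapB phi cphi phiB z Gz; rewrite !ler_norml => /andP[? ?].
  by apply/andP; split; lra.
have C_lsc g : C 0%N g -> lsc_on G g.
  move=> [phi [cphi _ _ gE]] z Gz a; rewrite gE// => ag.
  have ag' : a - e / 2 < gap phi z by lra.
  have := continuous_lsc (gap_cont _ cphi) Gz ag'.
  apply: (@filterS _ (nbhs z) (nbhs_filter z)) => z' H Gz'; rewrite gE//.
  by have := H Gz'; lra.
have C_pt z r : G z -> 0 < r -> exists N, forall g, C N g -> - r <= g z.
  move=> Gz r0; have /cvgrPdist_le/(_ r r0)[N _ /(_ N (leqnn N)) /= HN] :=
    cvg_mean bh hB h_cvg Gz.
  exists N => g [phi [cphi phiB hphi gE]]; rewrite gE//.
  have bphi := bounded_measurable_within_continuous cphi.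
  have : M (h N) z <= M phi z by apply: le_mean => // y /hphi /andP[].
  have /andP[_] := hphi _ (Yz z Gz); have := etaP z Gz; rewrite /gap.
  by move: HN; rewrite ler_norml => /andP[_ ?]; lra.
have G0 : G !=set0.
  by have [y Yy] := Y_neq0; have [u Uu] := U_neq0 Yy; exists (y, u).
have [g [phi [cphi _ _ gE]] ge] :=
  simons graphG_compact G0 C_decr C_mid C_bnd C_lsc C_nonempty C_pt e20.
by exists phi => // z Gz; have := ge z Gz; rewrite gE//; lra.
Qed.

Lemma le_dstar y0 : Y y0 -> ((v y0)%:E <= dstar s Y U f k y0)%E.
Proof.
move=> Yy0; apply/lee_addgt0Pr => e e0.
have [eta ceta etaP] := exists_continuous_subsolution e0.
rewrite -leeBlDr//; apply: le_ereal_sup_tmp; exists (v y0 - e)%:E;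
  last by rewrite EFinB.
exists (v y0 - e) => //; exists v, eta; split => // z Gz.
have beta := bounded_measurable_within_continuous ceta.
rewrite !meanfE// -!EFinD !lee_fin; split.
  by have := etaP z Gz; rewrite /gap; lra.
by rewrite subr_ge0 le_mean_limit.
Qed.


(** * Weak duality and periodic regimes *)

Let bounded_measurable_fst (phi : 'rV[R]_n -> R) : {within Y, continuous phi} ->
  @bounded_measurable R _ (borelYU n Uhat) G (fun z => phi z.1).
Proof.
move=> cphi; have cfst : {within G, continuous (fun z : Z => phi z.1)}.
  by apply: within_graph; exact: within_continuous_fst.
split; first by apply: lsc_borel_measurable => //; exact: continuous_lsc.
exact: within_continuous_bounded graphG_compact cfst.
Qed.

Let bounded_measurable_drift (phi : 'rV[R]_n -> R) : {within Y, continuous phi} ->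
  @bounded_measurable R _ (borelYU n Uhat) G (fun z => M phi z - phi z.1).
Proof.
move=> cphi; apply: bounded_measurableB; last exact: bounded_measurable_fst.
by apply: measurable_mean; exact: continuous_bounded_lsc.
Qed.

Let integral_drift (mu : {finite_measure set (borelYU n Uhat) -> \bar R})
    (phi : 'rV[R]_n -> R) : {within Y, continuous phi} ->
  (\int[mu]_(z in G) (meanf s f phi z - (phi z.1)%:E) =
   (\int[mu]_(z in G) (M phi z - phi z.1))%:E)%E.
Proof.
move=> cphi; rewrite -integral_bounded_measurable//;
  last exact: bounded_measurable_drift.
apply: eq_integral => z; rewrite inE => Gz; rewrite meanfE//.
exact: bounded_measurable_within_continuous.
Qed.

(** Integrate the first dual constraint against [gam]. Membership in [W] removes [eta], and the
    second condition of [inOmega] turns the [psi] term into minus the [xi]-integral of the drift of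
    [psi], which is nonnegative by the second constraint. *)
Lemma dstar_le_kstar y0 : Y y0 -> (dstar s Y U f k y0 <= kstar s Y U f k y0)%E.
Proof.
move=> Yy0; apply: ge_ereal_sup => _ [mu [psi [eta [cpsi ceta feas]]] <-].
apply: le_ereal_inf_tmp => _ [gam [xi [[[gamG gamW] xiG gamxi] ->]]].
have gamG1 : fine (gam G) = 1.
  have := probability_setC gam (measurableC G_borel).
  by rewrite setCK gamG sube0 => ->.
have integ := fun g => @bounded_measurable_integrable _ _ _ gam G g G_borel.
have bcst c := @bounded_measurable_cst R _ (borelYU n Uhat) G c.
have beta := bounded_measurable_drift ceta.
have bpsi := bounded_measurableB (bcst (psi y0)) (bounded_measurable_fst cpsi).
have W0 : \int[gam]_(z in G) (M eta z - eta z.1) = 0.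
  by have := gamW eta ceta; rewrite integral_drift// => -[].
have := gamxi psi cpsi; rewrite integral_drift// integral_bounded_measurable//.
rewrite -EFinD => -[Om0].
have xi0 : 0 <= \int[xi]_(z in G) (M psi z - psi z.1).
  apply: Rintegral_ge0 => z Gz; have [_] := feas z Gz.
  rewrite meanfE//; last exact: bounded_measurable_within_continuous.
rewrite integral_bounded_measurable// lee_fin -subr_ge0.
have : 0 <= \int[gam]_(z in G) (k z + (psi y0 - psi z.1) + (M eta z - eta z.1) - mu).
  apply: Rintegral_ge0 => z Gz; have [+ _] := feas z Gz.
  rewrite meanfE//; last exact: bounded_measurable_within_continuous.
  by rewrite -!EFinD lee_fin; lra.
have b1 := bounded_measurableD k_bounded_measurable bpsi.
have b2 := bounded_measurableD b1 beta.
rewrite RintegralB//; [|exact: integ b2|exact: integ (bcst mu)].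
rewrite RintegralD//; [|exact: integ b1|exact: integ beta].
rewrite RintegralD//; [|exact: integ k_bounded_measurable|exact: integ bpsi].
rewrite W0 Rintegral_cst// gamG1; lra.
Qed.

(** * Occupation measures of a periodic regime *)

Section Periodic.
Variables (y0 : 'rV[R]_n) (pi : plan n Uhat) (m p : nat).
Hypotheses (Yy0 : Y y0) (pi_plan : plans Y U pi) (p0 : (0 < p)%N).
Hypothesis periodic : forall q : Z -> R, {within Y `*` [set: Uhat], continuous q} ->
  forall t, (m <= t)%N ->
    ('E_P[fun w => q (traj s f pi y0 t w)] =
     'E_P[fun w => q (traj s f pi y0 (t + p) w)])%E.

Let X (i : nat) : {mfun Om >-> borelYU n Uhat} :=
  mfun_Sub (mem_set (measurable_traj pi_plan Yy0 i)).

Let bq (q : Z -> R) : {within Y `*` [set: Uhat], continuous q} ->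
  @bounded_measurable R _ (borelYU n Uhat) G q.
Proof.
move=> /within_graph cq; split; last exact: within_continuous_bounded graphG_compact cq.
by apply: lsc_borel_measurable => //; exact: continuous_lsc.
Qed.

Let periodicR (q : Z -> R) t : {within Y `*` [set: Uhat], continuous q} -> (m <= t)%N ->
  \int[P]_w q (traj s f pi y0 t w) = \int[P]_w q (traj s f pi y0 (t + p) w).
Proof.
move=> cq mt; have := periodic cq mt; rewrite !expectation_bounded_measurable.
- by move=> [].
- by apply: bounded_measurable_traj => //; exact: bq.
- by apply: bounded_measurable_traj => //; exact: bq.
Qed.

Let drift (phi : 'rV[R]_n -> R) i : {within Y, continuous phi} ->
  \int[P]_w (M phi (X i w) - phi (X i w).1) =
  \int[P]_w phi (state s f pi y0 i.+1 w) - \int[P]_w phi (state s f pi y0 i w).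
Proof.
move=> cphi; have lphi := continuous_bounded_lsc cphi.
rewrite integral_state_succ// -RintegralB//.
- apply: bounded_measurable_integrable => //; apply: bounded_measurable_traj => //.
  exact: measurable_mean.
- apply: bounded_measurable_integrable => //; apply: bounded_measurable_state => //.
  exact: bounded_measurable_bounded_lsc.
Qed.

Let p_inv0 : 0 <= p%:R^-1 :> R. Proof. by rewrite invr_ge0. Qed.

(* [gamma] averages the laws of the trajectory over one period, and [xi] averages
   over the same period the sum of the laws of all the earlier times. *)
Let gam_weight (i : nat) : {nonneg R} := NngNum (mulr_ge0 (ler0n R (m <= i)%N) p_inv0).

Let xi_weight_ge0 i : 0 <= \sum_(j < p) (i < m + j)%N%:R * p%:R^-1 :> R.
Proof. by apply: sumr_ge0 => j _; rewrite mulr_ge0. Qed.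

Let xi_weight (i : nat) : {nonneg R} := NngNum (xi_weight_ge0 i).

Let sum_gam_weight (x : nat -> R) :
  \sum_(i < m + p) (gam_weight i)%:num * x i = p%:R^-1 * \sum_(i < p) x (m + i)%N.
Proof.
rewrite -sum_shift_indic mulr_sumr; apply: eq_bigr => i _ /=.
by rewrite mulrAC mulrC mulrCA mulrA.
Qed.

Let sum_xi_weight (x : nat -> R) : \sum_(i < m + p) (xi_weight i)%:num * x i =
  p%:R^-1 * \sum_(j < p) \sum_(i < m + j) x i.
Proof.
transitivity (\sum_(j < p) \sum_(i < m + p) p%:R^-1 * ((i < m + j)%N%:R * x i)).
  rewrite exchange_big /=; apply: eq_bigr => i _; rewrite mulr_suml.
  by apply: eq_bigr => j _; rewrite mulrCA mulrA.
rewrite mulr_sumr; apply: eq_bigr => j _; rewrite -mulr_sumr sum_prefix_indic//.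
by rewrite leq_add2l ltnW.
Qed.

Let gam_sum1 : \sum_(i < m + p) (gam_weight i)%:num = 1.
Proof.
under eq_bigr do rewrite -[_%:num]mulr1.
rewrite (sum_gam_weight (fun=> 1)) sumr_const card_ord mulVf//.
by rewrite pnatr_eq0 -lt0n.
Qed.

Let gam : probability (borelYU n Uhat) R := weighted_probability P X gam_sum1.
Let xi : {finite_measure set (borelYU n Uhat) -> \bar R} :=
  weighted_law P X xi_weight (m + p).

Let law_offG c N : weighted_law P X c N (~` G) = 0%E.
Proof.
rewrite weighted_lawE big1// => i _.
rewrite [X in P X](_ : _ = set0) ?measure0 ?mule0//.
by apply/seteqP; split=> w //=; apply; exact: traj_graph.
Qed.

Let integral_gam g : @bounded_measurable R _ (borelYU n Uhat) G g ->
  (\int[gam]_(z in G) (g z)%:E =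
   (p%:R^-1 * \sum_(i < p) \int[P]_w g (traj s f pi y0 (m + i) w))%:E)%E.
Proof.
move=> bg; have XG i w : G (X i w) by exact: traj_graph.
rewrite (eq_measure_integral (weighted_law P X gam_weight (m + p)))//.
by rewrite integral_weighted_law// (sum_gam_weight (fun i => \int[P]_w g (X i w))).
Qed.

Let integral_xi g : @bounded_measurable R _ (borelYU n Uhat) G g ->
  (\int[xi]_(z in G) (g z)%:E =
   (p%:R^-1 * \sum_(j < p) \sum_(i < m + j) \int[P]_w g (traj s f pi y0 i w))%:E)%E.
Proof.
move=> bg; have XG i w : G (X i w) by exact: traj_graph.
by rewrite integral_weighted_law// (sum_xi_weight (fun i => \int[P]_w g (X i w))).
Qed.

(** Integrated drifts telescope along the trajectory. Over one period they give the difference of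
    expectations at times [m + p] and [m], which vanishes; over the times before [m + j] they cancel
    the [j]-th term of the [gam] integral. *)
Lemma periodic_inOmega : inOmega s Y U f y0 gam xi.
Proof.
split; [split; [exact: law_offG|]|exact: law_offG|] => phi cphi.
  rewrite integral_drift// -integral_bounded_measurable//;
    last exact: bounded_measurable_drift.
  rewrite integral_gam; last exact: bounded_measurable_drift.
  under eq_bigr do rewrite drift// -addnS.
  rewrite -(big_mkord xpredT (fun i => \int[P]_w phi (state s f pi y0 (m + i.+1) w) -
    \int[P]_w phi (state s f pi y0 (m + i) w))).
  rewrite (telescope_sumr (fun i => \int[P]_w phi (state s f pi y0 (m + i) w)))// addn0.
  have := periodicR (within_continuous_fst cphi) (leqnn m) => /= <-.
  by rewrite subrr mulr0.
rewrite integral_drift// -integral_bounded_measurable//;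
  last exact: bounded_measurable_drift.
rewrite integral_gam; last first.
  by apply: bounded_measurableB;
    [exact: bounded_measurable_cst|exact: bounded_measurable_fst].
rewrite integral_xi; last exact: bounded_measurable_drift.
rewrite -EFinD -mulrDr -big_split /= big1 ?mulr0// => i _.
under [X in _ + X]eq_bigr do rewrite drift//.
rewrite -(big_mkord xpredT (fun i => \int[P]_w phi (state s f pi y0 i.+1 w) -
  \int[P]_w phi (state s f pi y0 i w))).
rewrite (telescope_sumr (fun i => \int[P]_w phi (state s f pi y0 i w)))//.
rewrite RintegralB//; last 2 first.
- exact: bounded_measurable_integrable (bounded_measurable_cst _ _).
- apply: bounded_measurable_integrable => //; apply: bounded_measurable_state => //.
  exact: bounded_measurable_within_continuous.
by rewrite /= !Rintegral_probability_cst addrC subrKA subrr.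
Qed.

Lemma kstar_le_periodic : (kstar s Y U f k y0 <=
  limn (fun T : nat => (T%:R^-1)%:E * cost s f k pi y0 T)%E)%E.
Proof.
have L : (fun T : nat => (T%:R^-1)%:E * cost s f k pi y0 T)%E @ \oo -->
    (p%:R^-1 * \sum_(i < p) \int[P]_w k (traj s f pi y0 (m + i) w))%:E.
  under eq_fun do rewrite costE// -EFinM.
  apply: cvg_EFin; first exact: nearW.
  apply: (@cesaro_periodic _ (fun i => \int[P]_w k (traj s f pi y0 i w))) => // t.
  exact: periodicR.
rewrite (cvg_lim _ L)//; apply: ge_ereal_inf.
exists (\int[gam]_(z in G) (k z)%:E)%E; last by rewrite integral_gam.
by exists gam, xi; split=> //; exact: periodic_inOmega.
Qed.

End Periodic.

Lemma kstar_le_Vper y0 : Y y0 -> (kstar s Y U f k y0 <= Vper s Y U f k y0)%E.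
Proof.
move=> Yy0; apply: le_ereal_inf_tmp => _ [pi [pi_plan [m [p [p0 periodic]]]] <-].
exact: kstar_le_periodic Yy0 pi_plan p0 periodic.
Qed.


End Model.

Theorem corollary5p6 (R : realType) (n : nat) (Uhat : pointedMetricType R)
    (S : ptopologicalType) (d : measure_display) (Om : measurableType d)
    (P : probability Om R) (s : nat -> {RV P >-> borelType S})
    (Y : set 'rV[R]_n) (U : 'rV[R]_n -> set Uhat)
    (f : 'rV[R]_n * Uhat -> S -> 'rV[R]_n) (k : 'rV[R]_n * Uhat -> R)
    (Y_neq0 : Y !=set0)
    (Y_compact : compact Y)
    (Uhat_compact : compact [set: Uhat])
    (S_polish : polish_space R S)
    (s_indep : mutually_independent P (fun t => s t : Om -> borelType S))
    (s_ident : identically_distributed P (fun t => s t : Om -> borelType S))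
    (f_bounded : exists M : R, forall z x, Y z.1 -> `|f z x| <= M)
    (f_continuous : forall x,
       {within Y `*` [set: Uhat], continuous (fun z => f z x)})
    (f_measurable : forall z, Y z.1 ->
       @measurable_fun _ _ (borelType S) (borelType 'rV[R]_n) setT (f z))
    (U_neq0 : forall y, Y y -> U y !=set0)
    (U_compact : forall y, Y y -> compact (U y))
    (U_usc : usc_on Y U)
    (f_invariant : forall y u x, Y y -> U y u -> Y (f (y, u) x))
    (k_continuous : {within Y `*` [set: Uhat], continuous k})
    (v : 'rV[R]_n -> R)
    (v_limit : forall y, Y y ->
       (fun T : nat => vT s Y U f k T y) @ \oo --> (v y)%:E)
    (v_continuous : {within Y, continuous v})
    (y0 : 'rV[R]_n) (Yy0 : Y y0)
    (Vper_eq : Vper s Y U f k y0 = limn_einf (fun T : nat => vT s Y U f k T y0)) :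
  kstar s Y U f k y0 = dstar s Y U f k y0.
Proof.
apply/eqP; rewrite eq_le; apply/andP; split; last exact: dstar_le_kstar.
apply: (@le_trans _ _ (Vper s Y U f k y0)); first exact: kstar_le_Vper.
rewrite Vper_eq (cvg_limn_einf_sup (v_limit y0 Yy0)).1; exact: le_dstar.
Qed.
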